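(* Let $k\ge 2$ and $n\ge 1$ be integers, and suppose that $A = A(t)$ is a real-analytic function of $t\in[0,1]$ with values in the order $k$, dimension $n$ real symmetric hypermatrices. Then there are functions $\lambda_i:[0,1]\to\mathbb{C}$, $i\in\{1,\ldots,n(k-1)^{n-1}\}$, such that for every $t\in[0,1]$ the numbers $\lambda_i(t)$ are precisely the eigenvalues of $A(t)$ (listed with multiplicity), and each $\lambda_i$ is smooth ($C^\infty$) except at finitely many points.
   Context: A (cubical) hypermatrix of order $k$ and dimension $n$ is an array $A=[a_{i_1\cdots i_k}]$ with indices in $[n]=\{1,\ldots,n\}$; it is symmetric if its entries are invariant under permutation of the indices. $\mathbb{I}_n^k$ denotes the identity hypermatrix, with entry $1$ when all indices are equal and $0$ otherwise. For a symmetric hypermatrix $B=[b_{i_1\cdots i_k}]$ of order $k$ and dimension $n$, the hyperdeterminant $\det(B)$ is the resultant of the $n$ homogeneous polynomials of degree $k-1$ in the variables $x_1,\ldots,x_n$ given by $\sum_{i_2,\ldots,i_k=1}^n b_{i i_2\cdots i_k}x_{i_2}\cdots x_{i_k}$, $i\in[n]$, where the resultant is normalized so that $\det(\mathbb{I}_n^k)=1$. The characteristic polynomial of $A$ is $\det(\lambda\mathbb{I}_n^k-A)$, a monic polynomial in $\lambda$ of degree $n(k-1)^{n-1}$. The eigenvalues of $A$ are the complex roots of the characteristic polynomial, with their multiplicities as roots; equivalently (ignoring multiplicity) they are the $\lambda\in\mathbb{C}$ for which there is a nonzero $\mathbf{v}\in\mathbb{C}^n$ with $\sum_{i_2,\ldots,i_k=1}^n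 a_{i i_2\cdots i_k}v_{i_2}\cdots v_{i_k}=\lambda v_i^{k-1}$ for every $i\in[n]$. *)

(* Defs.v *)
From HB Require Import structures.
From mathcomp Require Import all_boot all_order all_algebra.
From mathcomp Require Import complex.
From mathcomp Require mpoly.
From mathcomp Require classical_sets reals topology normedtype sequences derive.

Set Implicit Arguments.
Unset Strict Implicit.
Unset Printing Implicit Defensive.

Import Order.TTheory GRing.Theory Num.Theory.
Local Open Scope ring_scope.

(* The notations of multinomials and of mathcomp-analysis cannot be in force
   together, hence the two modules: each imports only one of the libraries. *)
Module Algebra.
Import mpoly.

(* The index set of the universal coefficients u_{i,alpha}: an equation i and
   an exponent vector alpha of total degree d in n variables. *)
Definition coef_index (n d : nat) : finType :=
  ('I_n * {m : 'X_{1..n < d.+1} | mdeg m == d})%type.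

Notation num_coefs n d := #|coef_index n d|.

(* P(F_1, ..., F_n): the variable u_{i,alpha} of P is replaced by the
   coefficient of x^alpha in F_i. *)
Definition subst_coefs (n d : nat) (P : {mpoly int[num_coefs n d]})
    (S : comNzRingType) (F : 'I_n -> {mpoly S[n]}) : S :=
  mmap (intr : int -> S)
       (fun j => let u := enum_val j in (F u.1)@_(val (val u.2))) P.

Definition irreducible_mpoly (m : nat) (K : idomainType)
    (p : {mpoly K[m]}) : Prop :=
  [/\ p != 0, p \isn't a GRing.unit &
      forall q r : {mpoly K[m]}, p = q * r ->
        q \is a GRing.unit \/ r \is a GRing.unit].

(* The resultant of n forms of degree d in n variables, by its defining
   properties (Cox, Little and O'Shea, Using Algebraic Geometry, Chapter 3,
   Theorem 2.3): the unique integer polynomial in the coefficients that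
   vanishes exactly on the systems with a nontrivial zero, takes the value 1
   on x_1^d, ..., x_n^d, and is irreducible over the complex numbers. *)
Definition is_resultant (K : numClosedFieldType) (n d : nat)
    (Res : {mpoly int[num_coefs n d]}) : Prop :=
  [/\ forall F : 'I_n -> {mpoly K[n]},
        (forall i, F i \is d.-homog) ->
        (subst_coefs Res F = 0 <->
         exists2 v : 'I_n -> K, (exists i, v i != 0) &
           forall i, (F i).@[v] = 0),
      subst_coefs Res (fun i => 'X_i ^+ d : {mpoly int[n]}) = 1 &
      irreducible_mpoly (map_mpoly (intr : int -> K) Res)].

Definition hypermatrix (S : Type) (k n : nat) : Type := k.-tuple 'I_n -> S.

Definition symmetric_hm (S : Type) (k n : nat) (B : hypermatrix S k n) : Prop :=
  forall I J : k.-tuple 'I_n, perm_eq I J -> B I = B J.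

Definition id_hm (S : nzRingType) (k n : nat) : hypermatrix S k n :=
  fun I => (constant I)%:R.

(* sum over i_2, ..., i_k of b_{i i_2 ... i_k} x_{i_2} ... x_{i_k}; the sum
   ranges over the full index tuples whose first entry is i. *)
Definition hm_form (S : comNzRingType) (k n : nat) (B : hypermatrix S k n)
    (i : 'I_n) : {mpoly S[n]} :=
  \sum_(I : k.-tuple 'I_n | ohead I == Some i)
     B I *: \prod_(j <- behead I) 'X_j.

Definition hyperdet (k n : nat) (Res : {mpoly int[num_coefs n k.-1]})
    (S : comNzRingType) (B : hypermatrix S k n) : S :=
  subst_coefs Res (hm_form B).

Definition hm_char_poly (k n : nat) (Res : {mpoly int[num_coefs n k.-1]})
    (S : comNzRingType) (A : hypermatrix S k n) : {poly S} :=
  hyperdet Res (fun I => 'X * id_hm {poly S} I - (A I)%:P).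

End Algebra.

Module Analysis.
Import classical_sets reals topology normedtype sequences derive.
Import numFieldNormedType.Exports.
Local Open Scope classical_set_scope.

Definition real_analytic_on (R : realType) (D : set R) (f : R -> R) : Prop :=
  forall t0, D t0 -> exists (c : nat -> R) (r : R), 0 < r /\
    forall t, D t -> `|t - t0| < r ->
      series (fun j => c j * (t - t0) ^+ j) @ \oo --> f t.

(* As D need not be open, smoothness is that of an extension. *)
Definition smooth_at (R : realType) (D : set R) (f : R -> R) (t : R) : Prop :=
  exists (g : R -> R) (e : R), [/\ 0 < e,
    forall s, D s -> `|s - t| < e -> f s = g s &
    forall (m : nat) s, `|s - t| < e -> derivable (derive1n m g) s 1].

Definition complex_smooth_at (R : realType) (D : set R) (f : R -> R[i])
    (t : R) : Prop :=
  smooth_at D (fun s => complex.Re (f s)) t /\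
  smooth_at D (fun s => complex.Im (f s)) t.

End Analysis.

Export Algebra Analysis.

(* Main.v *)
Require Import Defs.
From HB Require Import structures.
From mathcomp Require Import all_boot all_order all_algebra.
From mathcomp Require Import zify ring lra.
From mathcomp Require Import complex.
From mathcomp Require mpoly.
From mathcomp Require separable classical_sets boolp all_classical reals topology.
From mathcomp Require normedtype sequences derive realfun exp.

(* The resultant is prime over K, so every polynomial in the coefficients that
   vanishes at its zeros is a multiple of it. Macaulay's determinants for the
   different equations are such polynomials; comparing degrees, the resultant
   has degree at most d^(n-1) in the coefficients of each of the n forms of
   degree d, and a system of products of linear forms shows that equality
   holds. Hence the characteristic polynomial is monic of degree n(k-1)^(n-1).

   For A(t) analytic, its coefficients lie in the integral domain of analytic
   functions on [0, 1], where a nonzero function has finitely many zeros.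
   Dividing by greatest common divisors with the derivative writes a polynomial
   over this domain, up to a nonzero constant of the domain, as a product of
   polynomials coprime to their derivatives. Such a factor has simple roots
   outside a finite set of t by Bezout, and simple roots are smooth functions
   of t which continue uniquely along an interval. *)

Set Implicit Arguments.
Unset Strict Implicit.
Unset Printing Implicit Defensive.

Import Order.TTheory GRing.Theory Num.Theory.
Local Open Scope ring_scope.

(** * Factorial rings *)
Module FactorialRings.
Import classical_sets boolp.

Section Factoriality.

(** [is_resultant] describes [Res] only by its zeros, one value and irreducibility, so its degree
    has to be extracted from divisibility. Irreducible becomes prime because polynomial rings over a
    field are factorial. Scaling one form multiplies its Macaulay determinant by a power of the
    scalar; a divisor of a monomial in the scale variable is again a monomial, so [Res] is
    homogeneous in each form before its degree there is known. For the leading coefficient, putting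
    1/s for lambda turns homogeneity into s^D p(1/s) = det(I - sA), whose value at s = 0 is 1. Over
    the domain of analytic functions division works only up to nonzero constants of the domain. The
    zeros of these constants join the exceptional set, as do 0 and 1, where coefficients have no
    two-sided neighbourhood inside [0, 1]. At exceptional points any listing of the roots is taken;
    elsewhere the labels come from continuation between consecutive exceptional points. *)

Definition rdvd (R : idomainType) (p a : R) := exists c, a = p * c.

Definition rprime (R : idomainType) (p : R) :=
  [/\ p != 0, p \isn't a GRing.unit &
      forall a b, rdvd p (a * b) -> rdvd p a \/ rdvd p b].

(** The factors are primes rather than irreducibles, so uniqueness is automatic and Gauss's lemma
    carries the property to polynomials. *)
Definition factorial_ring (R : idomainType) :=
  forall x : R, x != 0 -> exists u (s : seq R),
    [/\ u \is a GRing.unit, {in s, forall p, rprime p} & x = u * \prod_(p <- s) p].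

Variable R : idomainType.
Implicit Types (p a b c u : R) (f g h : {poly R}).

Lemma rdvd_prod p (s : seq R) u : rprime p -> u \is a GRing.unit ->
  rdvd p (u * \prod_(x <- s) x) -> exists2 x, x \in s & rdvd p x.
Proof.
case=> p0 pu pP uu; elim: s u uu => [|x s IH] u uu.
  rewrite big_nil mulr1 => -[c e]; case/negP: pu; apply/unitrP; exists (c * u^-1).
  by rewrite mulrC mulrA -e divrr.
rewrite big_cons mulrCA => /pP[xp|/IH[//|y ys yp]].
  by exists x => //; rewrite mem_head.
by exists y => //; rewrite in_cons ys orbT.
Qed.

Lemma rprime_irr p a b : rprime p -> p = a * b ->
  a \is a GRing.unit \/ b \is a GRing.unit.
Proof.
case=> p0 _ pP e.
have inv1 (x y : R) : y * x = 1 -> x \is a GRing.unit.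
  by move=> yx; apply/unitrP; exists y; split; last rewrite mulrC.
have [|[c ac]|[c bc]] := pP a b; first by exists 1; rewrite mulr1 e.
  by right; apply: (inv1 _ c); apply: (mulfI p0); rewrite mulrA -ac mulr1 -e.
by left; apply: (inv1 _ c); apply: (mulfI p0); rewrite mulrA -bc mulr1 mulrC -e.
Qed.

Lemma unit_polyC c : (c%:P \is a GRing.unit) = (c \is a GRing.unit).
Proof.
by rewrite poly_unitE coefC eqxx size_polyC; case: (eqVneq c 0) => //= ->; rewrite unitr0.
Qed.

Lemma rdvd_polyC p f : rdvd p%:P f <-> forall i, rdvd p f`_i.
Proof.
split=> [[g ->] i|H]; first by exists g`_i; rewrite coefCM.
pose c i := xget 0 [set c | f`_i = p * c]%classic.
have cP i : f`_i = p * c i.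
  by case: (H i) => d dE; exact: (@xgetPex _ 0 [set c | f`_i = p * c]%classic (ex_intro _ d dE)).
exists (\poly_(i < size f) c i); apply/polyP => i; rewrite coefCM coef_poly.
by case: ltnP => [_|le]; rewrite ?cP // mulr0 -cP nth_default.
Qed.

(** Gauss's lemma. If p divides neither f nor g, let a and b be the least indices of coefficients
    that p does not divide; in the coefficient a + b of the product every term except [f]_a * g[_b]
    is a multiple of p. *)
Lemma rprime_polyC p : rprime p -> rprime p%:P.
Proof.
move=> [p0 pu pP]; split; rewrite ?polyC_eq0 ?unit_polyC // => f g fg.
apply: contrapT => /not_orP[/rdvd_polyC nf /rdvd_polyC ng].
have min_coef h : ~ (forall i, rdvd p h`_i) ->
    exists m, ~ rdvd p h`_m /\ forall i, (i < m)%N -> rdvd p h`_i.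
  move=> /existsNP nh.
  have {}nh : exists i, ~~ `[< rdvd p h`_i >].
    by case: nh => i hi; exists i; apply/asboolP.
  case: (ex_minnP nh) => m /asboolP hm mmin; exists m; split=> // i im.
  by apply: contrapT => /asboolPn /mmin; rewrite leqNgt im.
have [a [fa fam]] := min_coef _ nf; have [b [gb gbm]] := min_coef _ ng.
have /rdvd_polyC/(_ (a + b)%N) := fg.
have alt : (a < (a + b).+1)%N by rewrite ltnS leq_addr.
rewrite coefM (bigD1 (Ordinal alt)) //= addKn => -[c cE].
suff [d dE] : rdvd p (\sum_(i < (a + b).+1 | i != Ordinal alt) f`_i * g`_(a + b - i)).
  suff : rdvd p (f`_a * g`_b) by case/pP.
  by exists (c - d); rewrite mulrBr -cE dE addrK.
apply: (big_ind (fun x => rdvd p x)) => [|x y [c1 ->] [c2 ->]|i ia].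
- by exists 0; rewrite mulr0.
- by exists (c1 + c2); rewrite mulrDr.
case: (ltnP i a) => [/fam [d ->]|ai]; first by exists (d * g`_(a + b - i)); rewrite mulrA.
have ai' : (a < i)%N by rewrite ltn_neqAle ai andbT eq_sym; exact: ia.
have /gbm[d ->] : (a + b - i < b)%N.
  by move: (ltn_ord i) ai'; clear; lia.
by exists (f`_i * d); rewrite mulrCA.
Qed.

Definition primitive_poly f := forall p, rprime p -> ~ rdvd p%:P f.

(** A prime dividing f divides its leading coefficient, hence is associated to one of the finitely
    many primes there; removing it shortens that list, so the extraction ends. *)
Lemma primitive_part f : factorial_ring R -> f != 0 ->
  exists (s : seq R) g, [/\ {in s, forall p, rprime p}, primitive_poly g &
     f = (\prod_(p <- s) p)%:P * g].
Proof.
move=> uR f0; have := uR (lead_coef f); rewrite lead_coef_eq0 f0.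
case/(_ isT) => u [s [uu sP fE]].
have [n le_sn] := ubnP (size s); elim: n => // n IH in f f0 u s uu sP fE le_sn *.
have [fp|/existsNP[p /not_implyP[pP /contrapT[g fg]]]] := pselect (primitive_poly f).
  by exists [::], f; split; rewrite ?big_nil ?mul1r.
have [p0 pu _] := pP.
have lE : lead_coef f = p * lead_coef g by rewrite fg lead_coefM lead_coefC.
have [|q qs [c qc]] := @rdvd_prod p s u pP uu; first by exists (lead_coef g); rewrite -fE.
have cu : c \is a GRing.unit.
  by case: (rprime_irr (sP _ qs) qc) => // pu'; rewrite pu' in pu.
have [|||||t [h [tP hP gh]]] := IH g _ (u * c) (rem q s) _ _ _ _.
- by apply: contraNneq f0 => g0; rewrite fg g0 mulr0.
- by rewrite unitrM uu.
- by move=> x /mem_rem; exact: sP.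
- by apply: (mulfI p0); rewrite -lE fE (perm_big _ (perm_to_rem qs)) big_cons /= {1}qc; ring.
- by rewrite size_rem //; case: (s) qs le_sn.
exists (p :: t), h; split=> // [x|]; first by rewrite in_cons => /predU1P[->|/tP].
by rewrite fg gh big_cons polyCM mulrA.
Qed.

(** The primes of c are cancelled one at a time: each divides g * h but not the primitive g, hence
    divides h. *)
Lemma primitive_dvd f g h c : factorial_ring R -> primitive_poly g -> c != 0 ->
  c%:P * f = g * h -> rdvd g f.
Proof.
move=> uR gP c0; have [u [s [uu sP ->]]] := uR _ c0.
elim: s sP h => [|p s IH] sP h.
  rewrite big_nil mulr1 => e; exists (u^-1%:P * h).
  by rewrite mulrCA -e mulrA -polyCM mulVr // mul1r.
rewrite big_cons mulrCA polyCM -mulrA => e.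
have pP : rprime p by apply: sP; rewrite mem_head.
have [p0 _ _] := pP.
have [_ _ /(_ g h)[]] := rprime_polyC pP; first by rewrite -e; exists ((u * \prod_(j <- s) j)%:P * f).
  by move=> /(gP _ pP).
move=> [k hk]; apply: (IH _ k).
  by move=> x xs; apply: sP; rewrite in_cons xs orbT.
have p0' : p%:P != 0 by rewrite polyC_eq0.
by apply: (mulfI p0'); rewrite e hk mulrCA.
Qed.

(** Over a domain [%|] means divisibility up to a nonzero constant, that is, over the fraction
    field; a primitive divisor divides already over R. *)
Lemma dvdp_primitive f g : factorial_ring R -> primitive_poly g ->
  g %| f -> rdvd g f.
Proof.
move=> uR gP /Pdiv.Idomain.dvdpP[[c q] /= c0 e].
by apply: (primitive_dvd (h := q) uR gP c0); rewrite mul_polyC e mulrC.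
Qed.

Lemma rdvd_dvdp f g : rdvd g f -> g %| f.
Proof. by case=> c ->; apply: Pdiv.Idomain.dvdp_mulr; apply: Pdiv.Idomain.dvdpp. Qed.

(** Strong induction on the size: the content splits into constant primes, and a nonconstant
    primitive part splits off a prime factor g, the primitive part of a nonconstant divisor of least
    size. *)
Lemma factorial_poly : factorial_ring R -> factorial_ring {poly R}.
Proof.
move=> uR f; have [n le_fn] := ubnP (size f).
elim: n => // n IH in f le_fn * => f0.
have [s [f1 [sP f1P fE]]] := primitive_part uR f0.
have f10 : f1 != 0 by apply: contraNneq f0 => e; rewrite fE e mulr0.
have s0 : (\prod_(p <- s) p)%:P != 0 by apply: contraNneq f0 => e; rewrite fE e mul0r.
have sf1 : size f1 = size f by rewrite fE size_Cmul // -polyC_eq0.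
have sP' : {in [seq p%:P | p <- s], forall x, rprime x}.
  by move=> _ /mapP[p ps ->]; apply: rprime_polyC; exact: sP.
have sE : (\prod_(p <- s) p)%:P = \prod_(x <- [seq p%:P | p <- s]) x.
  by rewrite big_map rmorph_prod.
suff [u [t [uu tP f1E]]] : exists (u : {poly R}) (s : seq {poly R}),
    [/\ u \is a GRing.unit, {in s, forall x, rprime x} & f1 = u * \prod_(x <- s) x].
  exists u, ([seq p%:P | p <- s] ++ t); split=> // [x|].
    by rewrite mem_cat => /orP[/sP'|/tP].
  by rewrite big_cat /= -sE fE f1E mulrCA.
have [sz1|sz1] := leqP (size f1) 1.
  have f1C := size1_polyC sz1.
  have [|u [t [uu tP e]]] := uR f1`_0; first by rewrite -polyC_eq0 -f1C.
  exists u%:P, [seq p%:P | p <- t]; split; rewrite ?unit_polyC //.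
    by move=> _ /mapP[p ps ->]; apply: rprime_polyC; exact: tP.
  by rewrite big_map -rmorph_prod /= -polyCM -e.
(* Least size makes the divisor irreducible over the fraction field: its gcd with any polynomial is
   constant or of the same size. *)
have exg : exists m, `[< exists g, [/\ (1 < size g)%N, g %| f1 & size g = m] >].
  by exists (size f1); apply/asboolP; exists f1; split; rewrite ?Pdiv.Idomain.dvdpp.
case: (ex_minnP exg) => m /asboolP[g0 [g01 g0f g0m]] gmin.
have {gmin} gmin h : (1 < size h)%N -> h %| f1 -> (size g0 <= size h)%N.
  by move=> h1 hf; rewrite g0m; apply: gmin; apply/asboolP; exists h.
have g00 : g0 != 0 by rewrite -size_poly_gt0 ltnW.
have [t [g [tP gP gE]]] := primitive_part uR g00.
have t0 : \prod_(p <- t) p != 0.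
  by rewrite -polyC_eq0; apply: contraNneq g00 => e; rewrite gE e mul0r.
have sg : size g = size g0 by rewrite gE size_Cmul.
have gf1 : g %| f1.
  apply: Pdiv.Idomain.dvdp_trans g0f; apply: rdvd_dvdp; rewrite gE.
  by exists (\prod_(p <- t) p)%:P; rewrite mulrC.
have [h f1h] := dvdp_primitive uR gP gf1.
have g1 : (1 < size g)%N by rewrite sg.
have gn0 : g != 0 by rewrite -size_poly_gt0 ltnW.
have gprime : rprime g.
  split=> //; first by rewrite poly_unitE eqn_leq leqNgt g1.
  move=> a b gab.
  have [cp|ncp] := boolP (Pdiv.Idomain.coprimep g a).
    right; apply: (dvdp_primitive uR gP).
    by rewrite -(Pdiv.Idomain.Gauss_dvdpr _ cp); exact: rdvd_dvdp.
  left; apply: (dvdp_primitive uR gP).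
  have d0 : gcdp g a != 0 by rewrite Pdiv.Idomain.gcdp_eq0 negb_and gn0.
  have d1 : (1 < size (gcdp g a))%N.
    by rewrite ltn_neqAle eq_sym -Pdiv.Idomain.coprimep_def ncp size_poly_gt0.
  have dg := Pdiv.Idomain.dvdp_gcdl g a.
  have : size (gcdp g a) = size g.
    apply/eqP; rewrite eqn_leq Pdiv.Idomain.dvdp_leq //= sg gmin //.
    exact: Pdiv.Idomain.dvdp_trans gf1.
  move=> /eqP; rewrite Pdiv.Idomain.dvdp_size_eqp // => e.
  by rewrite -(Pdiv.Idomain.eqp_dvdl _ e); exact: Pdiv.Idomain.dvdp_gcdr.
have h0 : h != 0 by apply: contraNneq f10 => e; rewrite f1h e mulr0.
have [|u [t' [uu t'P hE]]] := IH h _ h0.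
  rewrite -ltnS; apply: leq_trans le_fn; rewrite ltnS -sf1 f1h size_mul //.
  by move: g1; clear; lia.
exists u, (g :: t'); split=> // [x|]; first by rewrite in_cons => /predU1P[->|/t'P].
by rewrite big_cons f1h hE mulrCA.
Qed.

End Factoriality.

Section RingIsomorphism.
Variables (R S : idomainType) (f : {rmorphism R -> S}) (g : {rmorphism S -> R}).
Hypotheses (fK : cancel f g) (gK : cancel g f).

Lemma rdvd_iso a b : rdvd (f a) (f b) -> rdvd a b.
Proof. by case=> c e; exists (g c); rewrite -(fK b) e rmorphM fK. Qed.

Lemma rprime_iso p : rprime p -> rprime (f p).
Proof.
move=> [p0 pu pP]; split.
- by rewrite -(inj_eq (can_inj gK)) fK rmorph0.
- by apply: contra pu => /(rmorph_unit g); rewrite fK.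
move=> a b [c e].
have [|[d de]|[d de]] := pP (g a) (g b).
- by exists (g c); rewrite -rmorphM e rmorphM fK.
- by left; exists (f d); rewrite -rmorphM -de gK.
- by right; exists (f d); rewrite -rmorphM -de gK.
Qed.

End RingIsomorphism.

Lemma factorial_iso (R S : idomainType) (f : {rmorphism R -> S}) (g : {rmorphism S -> R}) :
  cancel f g -> cancel g f -> factorial_ring S -> factorial_ring R.
Proof.
move=> fK gK uS x x0; have [|u [s [uu sP e]]] := uS (f x).
  by rewrite -(inj_eq (can_inj gK)) fK rmorph0.
exists (g u), [seq g p | p <- s]; split; first exact: rmorph_unit.
  by move=> _ /mapP[p ps ->]; apply: (rprime_iso gK fK); exact: sP.
by rewrite big_map -rmorph_prod -rmorphM -e fK.
Qed.

Lemma factorial_irr_prime (R : idomainType) (p : R) : factorial_ring R ->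
  p != 0 -> p \isn't a GRing.unit ->
  (forall a b, p = a * b -> a \is a GRing.unit \/ b \is a GRing.unit) -> rprime p.
Proof.
move=> uR p0 pu pI; have [u [s [uu sP e]]] := uR _ p0.
case: s sP e => [|q s] sP; first by rewrite big_nil mulr1 => e; rewrite e uu in pu.
have qP : rprime q by apply: sP; rewrite mem_head.
rewrite big_cons mulrCA => e; have [q0 qu qd] := qP.
set v := u * _ in e; have vu : v \is a GRing.unit.
  by case: (pI _ _ e) => // qu'; rewrite qu' in qu.
split=> // a b [c ab]; have [|[d ->]|[d ->]] := qd a b.
- by exists (v * c); rewrite ab e -mulrA.
- by left; exists (v^-1 * d); rewrite e -mulrA mulVKr.
- by right; exists (v^-1 * d); rewrite e -mulrA mulVKr.
Qed.

End FactorialRings.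

(** * The resultant is homogeneous of degree n d^(n-1) *)
Module Resultants.
Import mpoly FactorialRings.

(** * The last variable split off from a multivariate polynomial *)

Section MpolyPoly.
Variables (n : nat) (R : comNzRingType).
Local Notation widen := (widen_ord (leqnSn n)).

(** The inverse of [muni]; this isomorphism carries the inductions on the number of variables. *)
Definition mpoly_of_poly (q : {poly {mpoly R[n]}}) : {mpoly R[n.+1]} :=
  (map_poly (@mwiden n R) q).['X_ord_max].

Fact mpoly_of_poly_is_zmod : zmod_morphism mpoly_of_poly.
Proof. by move=> p q; rewrite /mpoly_of_poly rmorphB hornerD hornerN. Qed.

Fact mpoly_of_poly_is_monoid : monoid_morphism mpoly_of_poly.
Proof.
split=> [|p q]; rewrite /mpoly_of_poly ?rmorph1 ?hornerC // rmorphM hornerM //.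
Qed.

HB.instance Definition _ := GRing.isZmodMorphism.Build _ _ mpoly_of_poly mpoly_of_poly_is_zmod.
HB.instance Definition _ := GRing.isMonoidMorphism.Build _ _ mpoly_of_poly mpoly_of_poly_is_monoid.

Lemma muniX (m : 'X_{1..n.+1}) :
  muni ('X_[m] : {mpoly R[n.+1]}) =
  'X_[[multinom (m (widen i)) | i < n]] *: 'X^(m ord_max).
Proof. by rewrite muniE msuppX big_seq1 mcoeffX eqxx scale1r. Qed.

Lemma mpoly_of_polyK : cancel mpoly_of_poly (@muni n R).
Proof.
have wC (c : {mpoly R[n]}) : muni (mwiden c) = c%:P.
  rewrite [in LHS](mpolyE c) [in RHS](mpolyE c) (raddf_sum (@mwiden n R)).
  rewrite (raddf_sum (@muni n R)) raddf_sum; apply: eq_bigr => m _ /=. rewrite mwidenZ mwidenX muniZ muniX.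
  rewrite mnmwiden_ordmax expr0 -mul_polyC.
  have -> : [multinom (mnmwiden m (widen i)) | i < n] = m.
    by apply/mnmP => i; rewrite mnmE mnmwiden_widen.
  by rewrite alg_polyC -polyCM mul_mpolyC.
move=> q; rewrite /mpoly_of_poly -[RHS]coefK poly_def.
rewrite (@horner_coef_wide _ (size q)) ?size_poly //.
rewrite (raddf_sum (@muni n R)); apply: eq_bigr => i _ /=.
rewrite coef_map rmorphM rmorphXn /= wC muniX mnm1E eqxx expr1 -mul_polyC.
have -> : [multinom (U_(ord_max)%MM (widen j)) | j < n] = 0%MM.
  by apply/mnmP => j; rewrite mnmE mnm1E mnm0E -val_eqE /= gtn_eqF.
by rewrite mpolyX0 scale1r mul_polyC.
Qed.

Lemma muniK : cancel (@muni n R) mpoly_of_poly.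
Proof.
move=> p; rewrite muniE rmorph_sum [RHS]mpolyE; apply: eq_bigr => m _ /=.
rewrite -mul_polyC rmorphM /= /mpoly_of_poly map_polyC map_polyXn hornerC hornerXn /=.
rewrite mwidenZ mwidenX -scalerAl mpolyXn -mpolyXD; congr (_ *: 'X_[_]).
apply/mnmP => i; rewrite mnmDE mulmnE mnm1E.
case: (unliftP ord_max i) => [j ->|->]; last first.
  by rewrite mnmwiden_ordmax eqxx mul1n.
have -> : lift ord_max j = widen j by apply: val_inj; rewrite /= /bump leqNgt ltn_ord.
by rewrite mnmwiden_widen mnmE -val_eqE /= gtn_eqF ?mul0n ?addn0.
Qed.

Definition extend_pt (v : 'I_n -> R) (y : R) (i : 'I_n.+1) : R :=
  if unlift ord_max i is Some j then v j else y.

Lemma meval_of_poly (q : {poly {mpoly R[n]}}) v y :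
  (mpoly_of_poly q).@[extend_pt v y] = (map_poly (meval v) q).[y].
Proof.
have wE (c : {mpoly R[n]}) : (mwiden c).@[extend_pt v y] = c.@[v].
  rewrite (mpolyE c) (raddf_sum (@mwiden n R)) !(raddf_sum (meval _)); apply: eq_bigr => m _ /=.
  rewrite mwidenZ mwidenX !mevalZ !mevalX big_ord_recr /= mnmwiden_ordmax expr0 mulr1.
  congr (_ * _); apply: eq_bigr => i _; rewrite mnmwiden_widen /extend_pt.
  have -> : widen i = lift ord_max i by apply: val_inj; rewrite /= /bump leqNgt ltn_ord.
  by rewrite liftK.
rewrite /mpoly_of_poly -horner_map /= mevalXU /extend_pt unlift_none -map_poly_comp.
by congr (_.[_]); apply: eq_map_poly => c /=; rewrite wE.
Qed.

Lemma meval_muni (p : {mpoly R[n.+1]}) v y :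
  (map_poly (meval v) (muni p)).[y] = p.@[extend_pt v y].
Proof. by rewrite -meval_of_poly muniK. Qed.

Lemma muni_eq0 (p : {mpoly R[n.+1]}) : (muni p == 0) = (p == 0).
Proof. by rewrite -(inj_eq (can_inj muniK)) rmorph0. Qed.

End MpolyPoly.

Lemma factorial_mpoly (n : nat) (K : fieldType) : factorial_ring {mpoly K[n]}.
Proof.
elim: n => [|n IH].
  move=> x x0; exists x, [::]; split; rewrite ?big_nil ?mulr1 //.
  rewrite (nvar0_mpolyC x) in x0 *; rewrite rmorph_unit // unitfE.
  by rewrite mpolyC_eq0 in x0.
exact: factorial_iso (@muniK n K) (@mpoly_of_polyK n K) (factorial_poly IH).
Qed.

Lemma poly_nonroot (R : numDomainType) (p : {poly R}) : p != 0 ->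
  exists s : nat, p.[s%:R] != 0.
Proof.
move=> p0; have : ~~ all (root p) [seq i%:R | i <- iota 0 (size p)].
  apply/negP => /max_poly_roots; rewrite size_map size_iota ltnn p0 => H.
  by have : false by apply: H => //; rewrite map_inj_uniq ?iota_uniq //; exact: (@mulrIn _ 1 (oner_neq0 _)).
by case/allPn => _ /mapP[s _ ->] ?; exists s.
Qed.

(** A point where the leading coefficient in the last variable is nonzero leaves a nonzero
    univariate polynomial, which does not vanish at all natural numbers. *)
Lemma mpoly_nonroot (n : nat) (R : numDomainType) (p : {mpoly R[n]}) : p != 0 ->
  exists v : 'I_n -> R, p.@[v] != 0.
Proof.
elim: n p => [|n IH] p p0.
  by exists (fun=> 0); move: p0; rewrite (nvar0_mpolyC p) mevalC mpolyC_eq0.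
have : lead_coef (muni p) != 0.
  by rewrite lead_coef_eq0 muni_eq0.
move=> /IH[v lv]; have /poly_nonroot[s sv] : map_poly (meval v) (muni p) != 0.
  by apply: contraNneq lv => e; rewrite lead_coefE -coef_map e coef0.
by exists (extend_pt v s%:R); rewrite -meval_muni.
Qed.

(* By elimination: if P has positive degree and P, Q were coprime over the
   fraction field of S, then Bezout would give a nonzero e : S that vanishes
   at every evaluation where the leading coefficient of P does not. *)
Lemma prime_zeros_dvd_poly (S : idomainType) (K : numClosedFieldType) (I : Type)
    (ev : I -> {rmorphism S -> K}) (P Q : {poly S}) :
  (forall e : S, e != 0 -> exists v, ev v e != 0) ->
  (forall p q, rprime p -> (forall v, ev v p = 0 -> ev v q = 0) -> rdvd p q) ->
  rprime P ->
  (forall v y, (map_poly (ev v) P).[y] = 0 -> (map_poly (ev v) Q).[y] = 0) ->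
  rdvd P Q.
Proof.
move=> ev_neq0 dvdS [P0 Pu PP] PQ.
(* For constant P, the specialization of Q vanishes identically in y wherever P vanishes, so the
   hypothesis on S applies to each coefficient of Q. *)
have [sP|sP] := leqP (size P) 1.
  have PC := size1_polyC sP; set c := P`_0 in PC.
  have c0 : c != 0 by rewrite -polyC_eq0 -PC.
  have cpr : rprime c.
    split=> // [|a b [d ab]]; first by apply: contra Pu => cu; rewrite PC unit_polyC.
    have [|[f e]|[f e]] := PP a%:P b%:P.
    - by exists d%:P; rewrite PC -!polyCM ab.
    - by left; exists f`_0; rewrite -(coefCM c f) -PC -e coefC.
    - by right; exists f`_0; rewrite -(coefCM c f) -PC -e coefC.
  rewrite PC; apply/rdvd_polyC => i; apply: dvdS => // v cv.
  have : map_poly (ev v) Q == 0.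
    apply: contraT => /poly_nonroot[s]; rewrite PQ ?eqxx //.
    by rewrite PC map_polyC hornerC.
  by move=> /eqP/polyP/(_ i); rewrite coef_map coef0.
have [cp|ncp] := boolP (Pdiv.Idomain.coprimep P Q); last first.
  (* With a common factor g of positive degree, P divides c P = h g but not the smaller h, so it
     divides g, hence d Q, hence Q because d is a nonzero constant. *)
  set g := gcdp P Q.
  have g1 : (1 < size g)%N.
    rewrite ltn_neqAle eq_sym -Pdiv.Idomain.coprimep_def ncp size_poly_gt0.
    by rewrite Pdiv.Idomain.gcdp_eq0 negb_and P0.
  have [[c h] /= c0 eP] := Pdiv.Idomain.dvdpP _ _ (Pdiv.Idomain.dvdp_gcdl P Q).
  have [[d k] /= d0 eQ] := Pdiv.Idomain.dvdpP _ _ (Pdiv.Idomain.dvdp_gcdr P Q).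
  have small (f : {poly S}) : f != 0 -> (size f < size P)%N -> ~ rdvd P f.
    move=> f0 sf /rdvd_dvdp /(Pdiv.Idomain.dvdp_leq f0).
    by rewrite leqNgt sf.
  have hg0 : h * g != 0 by rewrite -eP -mul_polyC mulf_neq0 ?polyC_eq0.
  have [g0 h0] : g != 0 /\ h != 0 by move: hg0; rewrite mulf_eq0 negb_or => /andP[].
  have [|/small[]//|[r gr]] := PP h g.
  - by exists c%:P; rewrite -eP -mul_polyC mulrC.
  - rewrite -(size_scale P c0) eP -/g size_mul //.
    by move: g1 h0; rewrite -(size_poly_gt0 h); move: (size g) (size h); clear; lia.
  have [|/small[]|//] := PP d%:P Q.
  - by exists (k * r); rewrite mul_polyC eQ -/g gr mulrCA.
  - by rewrite polyC_eq0.
  - by rewrite size_polyC d0.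
have [[u v] /= uv] := Pdiv.Idomain.Bezout_coprimepP _ _ cp.
have /size_poly1P[e e0 uvE] : size (u * P + v * Q) == 1 by rewrite (Pdiv.Idomain.eqp_size uv) size_poly1.
have [x] : exists x, ev x (e * lead_coef P) != 0.
  by apply: ev_neq0; rewrite mulf_neq0 ?lead_coef_eq0.
rewrite rmorphM mulf_eq0 negb_or => /andP[ex lx].
have [y Py] : exists y, root (map_poly (ev x) P) y.
  by apply/closed_rootP; rewrite size_map_poly_id0 ?neq_ltn ?sP ?orbT.
have := congr1 (fun f => (map_poly (ev x) f).[y]) uvE.
rewrite /= rmorphD !rmorphM hornerD !hornerM (eqP Py) PQ; last exact/eqP.
by rewrite !mulr0 addr0 map_polyC hornerC /= => /esym/eqP; rewrite (negPf ex).
Qed.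

(** The Nullstellensatz for a principal prime ideal, by induction on the variables. Without
    variables nonzero elements are units, so there is no prime. *)
Lemma prime_zeros_dvd (n : nat) (K : numClosedFieldType) (p q : {mpoly K[n]}) :
  rprime p -> (forall v, p.@[v] = 0 -> q.@[v] = 0) -> rdvd p q.
Proof.
elim: n p q => [|n IH] p q prp pq.
  have [p0 pu _] := prp; case/negP: pu; rewrite (nvar0_mpolyC p) in p0 *.
  by rewrite rmorph_unit // unitfE; rewrite mpolyC_eq0 in p0.
apply: (rdvd_iso (@muniK n K)).
apply: (@prime_zeros_dvd_poly _ K ('I_n -> K) (fun v => meval v)).
- exact: mpoly_nonroot.
- exact: IH.
- exact: (rprime_iso (@muniK n K) (@mpoly_of_polyK n K)).
move=> v y h; apply: etrans (meval_muni q v y) _; apply: pq.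
exact: etrans (esym (meval_muni p v y)) h.
Qed.

(** * Homogeneous forms and their coefficient vectors *)

Local Notation monomials n e := {m : 'X_{1..n < e.+1} | mdeg m == e}.

Section HomogeneousForms.
Variables (n e : nat).

Definition mon_exp (m : monomials n e) : 'X_{1..n} := val (val m).

Lemma mdeg_mon m : mdeg (mon_exp m) = e.
Proof. exact/eqP/(valP m). Qed.

Lemma mon_exp_inj : injective mon_exp.
Proof. by move=> a b /val_inj/val_inj. Qed.

Lemma mon_of_exp (m : 'X_{1..n}) : mdeg m = e -> exists a, mon_exp a = m.
Proof.
move=> me; have lt_m : (mdeg m < e.+1)%N by rewrite me.
by exists (Sub (BMultinom lt_m) (introT eqP me)).
Qed.

Lemma dhomog_mpolyE (R : nzRingType) (p : {mpoly R[n]}) : p \is e.-homog ->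
  p = \sum_(m : monomials n e) p@_(mon_exp m) *: 'X_[mon_exp m].
Proof.
move=> ph; have sp : (msize p <= e.+1)%N.
  rewrite msizeE; apply/bigmax_leqP_seq => m mp _.
  by rewrite (dhomog_mf ph).
rewrite {1}(mpolywE sp) (bigID (fun m : 'X_{1..n < e.+1} => mdeg m == e)) /=.
rewrite [X in _ + X]big1 ?addr0; last first.
  by move=> m me; rewrite (dhomog_nemf_coeff ph me) scale0r.
exact: (big_sub [pred m : 'X_{1..n < e.+1} | mdeg m == e]
  (fun m => p@_(val m) *: 'X_[val m] : {mpoly R[n]})).
Qed.

Lemma mcoeff_sum_mon (R : nzRingType) (c : monomials n e -> R) a :
  (\sum_m c m *: 'X_[mon_exp m])@_(mon_exp a) = c a.
Proof.
rewrite raddf_sum (bigD1 a) //= mcoeffZ mcoeffX eqxx mulr1 big1 ?addr0 // => b ba.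
by rewrite mcoeffZ mcoeffX (inj_eq mon_exp_inj) (negPf ba) mulr0.
Qed.

Lemma meval_dhomog (R : comNzRingType) (p : {mpoly R[n]}) v : p \is e.-homog ->
  p.@[v] = \sum_m p@_(mon_exp m) * \prod_i v i ^+ mon_exp m i.
Proof.
move=> ph; rewrite {1}(dhomog_mpolyE ph) raddf_sum; apply: eq_bigr => m _ /=.
by rewrite mevalZ mevalX.
Qed.

End HomogeneousForms.

Section CoefficientVectors.
Variables n d : nat.
Local Notation N := (num_coefs n d).

Definition coefs (S : nzRingType) (F : 'I_n -> {mpoly S[n]}) (j : 'I_N) : S :=
  (F (enum_val j).1)@_(mon_exp (enum_val j).2).

(** Inverse to [coefs] on systems of degree d. With the variables themselves as coefficients it is
    the generic system. *)
Definition forms (S : nzRingType) (u : 'I_N -> S) (i : 'I_n) : {mpoly S[n]} :=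
  \sum_(m : monomials n d)
    u (enum_rank ((i, m) : coef_index n d)) *: 'X_[mon_exp m].

Lemma forms_dhomog (S : nzRingType) (u : 'I_N -> S) i : forms u i \is d.-homog.
Proof.
by apply: rpred_sum => m _; rewrite dhomogZ // dhomogX /= mdeg_mon.
Qed.

Lemma coefs_forms (S : nzRingType) (u : 'I_N -> S) : coefs (forms u) =1 u.
Proof.
move=> j; rewrite /coefs mcoeff_sum_mon -surjective_pairing; exact: congr1 (enum_valK j).
Qed.

Lemma forms_coefs (S : nzRingType) (F : 'I_n -> {mpoly S[n]}) :
  (forall i, F i \is d.-homog) -> forms (coefs F) =1 F.
Proof.
move=> Fh i; rewrite [RHS](dhomog_mpolyE (Fh i)); apply: eq_bigr => m _.
by rewrite /coefs enum_rankK.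
Qed.

Lemma map_forms (R S : nzRingType) (f : {rmorphism R -> S}) (u : 'I_N -> R) i :
  map_mpoly f (forms u i) = forms (f \o u) i.
Proof.
by rewrite raddf_sum; apply: eq_bigr => m _ /=; rewrite map_mpolyZ map_mpolyX.
Qed.

Lemma subst_coefs_meval (P : {mpoly int[N]}) (S : comNzRingType)
    (F : 'I_n -> {mpoly S[n]}) :
  subst_coefs P F = (map_mpoly (intr : int -> S) P).@[coefs F].
Proof.
rewrite [in RHS](mpolyE P) (raddf_sum (map_mpoly _)) (raddf_sum (meval _)).
by rewrite /subst_coefs [LHS]/mmap; apply: eq_bigr => m _ /=; rewrite map_mpolyZ map_mpolyX mevalZ mevalX.
Qed.

Lemma eq_subst_coefs (P : {mpoly int[N]}) (S : comNzRingType)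
    (F G : 'I_n -> {mpoly S[n]}) : F =1 G -> subst_coefs P F = subst_coefs P G.
Proof. by move=> FG; rewrite !subst_coefs_meval; apply: meval_eq => j; rewrite /coefs FG. Qed.

Lemma rmorph_subst_coefs (P : {mpoly int[N]}) (S S' : comNzRingType)
    (f : {rmorphism S -> S'}) (F : 'I_n -> {mpoly S[n]}) :
  f (subst_coefs P F) = subst_coefs P (fun i => map_mpoly f (F i)).
Proof.
rewrite /subst_coefs /mmap raddf_sum; apply: eq_bigr => m _ /=.
rewrite rmorphM rmorph_int /mmap1 rmorph_prod; congr (_ * _).
by apply: eq_bigr => i _; rewrite rmorphXn mcoeff_map_mpoly.
Qed.

End CoefficientVectors.

(* Macaulay's determinant for n.+1 forms of degree d.+1 in n.+1 variables. The
   row of a monomial x^a of degree (n.+1 * d).+1 holds the coefficients of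
   x^a / x_i^(d.+1) * F_i for some i with d < a_i; the form F_j is used only
   when no other i is possible, which happens for (d.+1)^n monomials. *)
Section Macaulay.
Variables (n d : nat).
Local Notation deg := (n.+1 * d).+1.
Local Notation mon := (monomials n.+1 deg).
Local Notation mexp := (@mon_exp n.+1 deg).

Definition row_form (j : 'I_n.+1) (a : mon) : 'I_n.+1 :=
  odflt j [pick i | (i != j) && (d < mexp a i)%N].

(** Pigeonhole: exponents all at most d would sum to at most n.+1 * d, one less than the degree. So
    when the default j is taken, its own exponent exceeds d. *)
Lemma row_form_gt j a : (d < mexp a (row_form j a))%N.
Proof.
rewrite /row_form; case: pickP => [i /andP[] //|small] /=.
have := mdeg_mon a; rewrite mdegE (bigD1 j) //= => e.
have : (\sum_(i < n.+1 | i != j) mexp a i <= \sum_(i < n.+1 | i != j) d)%N.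
  by apply: leq_sum => i ij; rewrite leqNgt; have := small i; rewrite ij => /= ->.
rewrite sum_nat_const cardC1 card_ord /= => le.
move: e le; move: (mexp a j) (\sum_(_ < _ | _) _)%N (mulSn n d); clear; lia.
Qed.

Definition macaulay_row (S : comNzRingType) j (F : 'I_n.+1 -> {mpoly S[n.+1]}) a :=
  'X_[mexp a - U_(row_form j a) *+ d.+1] * F (row_form j a).

Definition macaulay_mx (S : comNzRingType) j (F : 'I_n.+1 -> {mpoly S[n.+1]}) :=
  \matrix_(a < #|{: mon}|, b < #|{: mon}|)
    (macaulay_row j F (enum_val a))@_(mexp (enum_val b)).

Definition macaulay (S : comNzRingType) j (F : 'I_n.+1 -> {mpoly S[n.+1]}) : S :=
  \det (macaulay_mx j F).

Lemma rmorph_macaulay (S S' : comNzRingType) (f : {rmorphism S -> S'}) j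
    (F : 'I_n.+1 -> {mpoly S[n.+1]}) :
  f (macaulay j F) = macaulay j (fun i => map_mpoly f (F i)).
Proof.
rewrite /macaulay -det_map_mx; congr (\det _); apply/matrixP => a b.
by rewrite !mxE -mcoeff_map_mpoly rmorphM /= map_mpolyX.
Qed.

Lemma eq_macaulay (S : comNzRingType) j (F G : 'I_n.+1 -> {mpoly S[n.+1]}) :
  F =1 G -> macaulay j F = macaulay j G.
Proof.
by move=> FG; congr (\det _); apply/matrixP => a b; rewrite !mxE /macaulay_row FG.
Qed.

Lemma sub_row_form j a :
  (U_(row_form j a) *+ d.+1 <= mexp a)%MM.
Proof.
apply/mnm_lepP => i; rewrite mulmnE mnm1E; case: eqP => [<-|_]; last by rewrite mul0n.
by rewrite mul1n row_form_gt.
Qed.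

(** The monomials evaluated at a common zero v form a kernel vector, since each row then evaluates
    to a multiple of some F_i(v). It is nonzero at the pure power of a variable with nonzero
    value. *)
Lemma macaulay_common_zero (K : fieldType) j (F : 'I_n.+1 -> {mpoly K[n.+1]}) v :
  (forall i, F i \is d.+1.-homog) -> (exists i, v i != 0) ->
  (forall i, (F i).@[v] = 0) -> macaulay j F = 0.
Proof.
move=> Fh [i vi] Fv; rewrite /macaulay -det_tr; apply/eqP/det0P.
exists (\row_b \prod_k v k ^+ mexp (enum_val b) k).
  have [a ae] : exists a : mon, mexp a = (U_(i) *+ deg)%MM.
    by apply: mon_of_exp; rewrite mdegMn mdeg1 mul1n.
  apply/eqP => /matrixP/(_ 0 (enum_rank a)); rewrite !mxE enum_rankK ae => /eqP.
  rewrite prodf_seq_eq0 => /hasP[k _]; rewrite mulmnE mnm1E expf_eq0 /=.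
  by case: eqP => [<-|_]; rewrite ?mul0n // (negPf vi) andbF.
apply/matrixP => r a; rewrite !mxE; set b := enum_val a.
have rh : macaulay_row j F b \is deg.-homog.
  have -> : deg = (mdeg (mexp b - U_(row_form j b) *+ d.+1)%MM + d.+1)%N.
    have := congr1 mdeg (submK (sub_row_form j b)).
    by rewrite mdegD (mdegMn U_(_)%MM) mdeg1 mul1n mdeg_mon.
  by rewrite /macaulay_row dhomogM ?dhomogX.
have e0 : (macaulay_row j F b).@[v] = 0 by rewrite /macaulay_row mevalM Fv mulr0.
rewrite -[RHS]e0 (meval_dhomog v rh).
rewrite [RHS](reindex (@enum_val _ {: mon})) /=; last exact/onW_bij/enum_val_bij.
by apply: eq_bigr => c _; rewrite !mxE mulrC.
Qed.

(** Each row polynomial is its own monomial again, so the matrix is the identity. *)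
Lemma macaulay_powers (S : comNzRingType) j :
  macaulay j (fun i => 'X_i ^+ d.+1 : {mpoly S[n.+1]}) = 1.
Proof.
rewrite /macaulay -[RHS](det1 S #|{: mon}|); congr (\det _); apply/matrixP => a b.
rewrite !mxE /macaulay_row mpolyXn -mpolyXD submK ?sub_row_form //.
by rewrite mcoeffX (inj_eq (@mon_exp_inj _ _)) (inj_eq enum_val_inj).
Qed.

Definition scale_form (S : comNzRingType) (j : 'I_n.+1) (s : S)
    (F : 'I_n.+1 -> {mpoly S[n.+1]}) i := (if i == j then s else 1) *: F i.

Lemma macaulay_scale (S : comNzRingType) j s (F : 'I_n.+1 -> {mpoly S[n.+1]}) :
  macaulay j (scale_form j s F) = s ^+ #|[set a : mon | row_form j a == j]| * macaulay j F.
Proof.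
rewrite /macaulay.
have -> : macaulay_mx j (scale_form j s F) =
    diag_mx (\row_a (if row_form j (enum_val a) == j then s else 1)) *m macaulay_mx j F.
  apply/matrixP => a b; rewrite mul_diag_mx !mxE.
  by rewrite /macaulay_row /scale_form -scalerAr mcoeffZ.
rewrite det_mulmx det_diag; congr (_ * _).
under eq_bigr do rewrite mxE.
rewrite -(big_enum_val (fun a : mon => if row_form j a == j then s else 1)) /=.
rewrite -big_mkcond /= prodr_const; congr (_ ^+ _).
by apply: eq_card => a; rewrite !inE.
Qed.

(** If F_j is used, all other exponents are at most d, and they determine the exponent of x_j
    through the total degree. *)
Lemma card_row_form j : (#|[set a : mon | row_form j a == j]| <= d.+1 ^ n)%N.
Proof.
pose f (a : mon) : {ffun 'I_n -> 'I_d.+1} := [ffun i => inord (mexp a (lift j i))].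
have small a i : row_form j a = j -> i != j -> (mexp a i < d.+1)%N.
  rewrite /row_form; case: pickP => [k /andP[kj _] /= e|sm _ ij]; first by rewrite e eqxx in kj.
  by rewrite ltnS leqNgt; have := sm i; rewrite ij => /= ->.
rewrite -[X in (_ <= X ^ _)%N](card_ord d.+1) -[X in (_ <= _ ^ X)%N](card_ord n) -card_ffun.
rewrite -(@card_in_imset _ _ f); first exact: max_card.
move=> a b; rewrite !inE => /eqP aj /eqP bj /ffunP fab; apply: mon_exp_inj.
have ab i : i != j -> mexp a i = mexp b i.
  move=> ij; case: (unliftP j i) ij => [k ->|->]; last by rewrite eqxx.
  move=> kj; have := fab k; rewrite !ffunE => /(congr1 val).
  by rewrite /= !inordK // small.
apply/mnmP => i; have [->|/ab//] := eqVneq i j.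
have := etrans (mdeg_mon a) (esym (mdeg_mon b)); rewrite !mdegE (bigD1 j) //= [RHS](bigD1 j) //=.
under eq_bigr => k kj do rewrite ab //.
by move/addIn.
Qed.

End Macaulay.

(** * Degree of the resultant in each form *)

Lemma monomial_divisor (T : idomainType) (p q : {poly T}) c a :
  c != 0 -> p * q = c *: 'X^a -> exists r b, (b <= a)%N /\ p = r *: 'X^b.
Proof.
move=> c0 pq; have : p %| ('X - 0%:P) ^+ a.
  by apply/Pdiv.Idomain.dvdpP; exists (c, q) => //=; rewrite polyC0 subr0 -pq mulrC.
case/Pdiv.Idomain.dvdp_exp_XsubCP => b ba; rewrite polyC0 subr0 => /Pdiv.Idomain.eqpP.
case=> -[c1 c2] /= /andP[c10 c20] e; exists p`_b, b; split=> //.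
apply/polyP => i; rewrite coefZ coefXn; case: eqP => [->|/eqP ib]; first by rewrite mulr1.
apply: (mulfI c10); rewrite mulr0 mulr0; have := congr1 (fun f : {poly T} => f`_i) e.
by rewrite /= !coefZ coefXn (negPf ib) mulr0.
Qed.

(** q is the reversal of p in degree b. This yields both the bound on the degree of p and its
    coefficient at b, including the case where that coefficient is zero. *)
Lemma reverse_horner (K : numFieldType) (p q : {poly K}) b :
  (forall s, s != 0 -> s ^+ b * p.[s^-1] = q.[s]) ->
  (size p <= b.+1)%N /\ p`_b = q`_0.
Proof.
move=> pq.
pose m := (size p).-1; pose r := \poly_(i < m.+1) p`_(m - i).
have pm : (size p <= m.+1)%N by rewrite /m; case: (size p).
have rE s : s != 0 -> s ^+ m * p.[s^-1] = r.[s].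
  move=> s0; rewrite (horner_coef_wide _ pm) horner_poly mulr_sumr.
  rewrite (reindex_inj rev_ord_inj) /=; apply: eq_bigr => i _; rewrite subSS mulrCA; congr (_ * _).
  have im : (i <= m)%N by rewrite -ltnS.
  by rewrite -{1}(subnKC im) exprD -mulrA exprVn mulfV ?mulr1 ?expf_neq0.
(* The difference is multiplied by ['X] so that a nonroot of the product is a nonzero point, where
   both evaluations are known. *)
have key : 'X^b * r = 'X^m * q.
  apply/eqP; rewrite -subr_eq0 -[_ == 0]orFb -(polyX_eq0 K) -mulf_eq0.
  apply: contraT => /poly_nonroot[s].
  rewrite hornerM hornerX mulf_eq0 negb_or => /andP[s0].
  rewrite !hornerE -(rE _ s0) -(pq _ s0) [X in _ - X]mulrCA.
  by rewrite subrr eqxx.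
have r0 : r`_0 = p`_m by rewrite coef_poly subn0.
have [bm|mb] := ltnP b m.
  have /(congr1 (fun f : {poly K} => f`_b)) := key.
  rewrite !coefXnM ltnn subnn bm r0 => /eqP; rewrite -lead_coefE lead_coef_eq0 => /eqP p0.
  by move: bm; rewrite /m p0 size_poly0.
split; first by rewrite (leq_trans pm).
have /(congr1 (fun f : {poly K} => f`_m)) := key.
rewrite !coefXnM ltnn subnn.
have [bm|mb'] := leqP b m.
  have -> : b = m by apply/eqP; rewrite eqn_leq bm mb.
  by rewrite subnn r0.
move=> <-; rewrite nth_default //; exact: leq_trans pm _.
Qed.

Section GroupScaling.
Variables (n d : nat) (K : fieldType) (j : 'I_n).
Local Notation N := (num_coefs n d).

Definition group_factor (S : nzRingType) (s : S) (c : 'I_N) : S :=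
  if (enum_val c).1 == j then s else 1.

(** The new variable counts the degree in the coefficients of the form of index j. *)
Definition group_scale : {mpoly K[N]} -> {poly {mpoly K[N]}} :=
  mmap (polyC \o @mpolyC N K) (fun c => group_factor 'X c * ('X_c)%:P).

HB.instance Definition _ := GRing.RMorphism.on group_scale.

Lemma group_scaleXU c : group_scale 'X_c = group_factor 'X c * ('X_c)%:P.
Proof. by rewrite /group_scale mmapX mmap1U. Qed.

Lemma horner_group_scale p (u : 'I_N -> K) s :
  (map_poly (meval u) (group_scale p)).[s] = p.@[fun c => group_factor s c * u c].
Proof.
rewrite /group_scale /mmap raddf_sum -horner_evalE raddf_sum [RHS]mevalE.
apply: eq_bigr => m _ /=; rewrite horner_evalE rmorphM hornerM /= map_polyC /= mevalC hornerC.
congr (_ * _); rewrite /mmap1 rmorph_prod horner_prod; apply: eq_bigr => c _ /=.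
rewrite rmorphXn horner_exp rmorphM hornerM /= map_polyC hornerC /= mevalXU.
by congr ((_ * _) ^+ _); rewrite /group_factor; case: ifP => _; rewrite ?map_polyX ?hornerX // rmorph1 hornerC.
Qed.

End GroupScaling.

Section ResultantDegree.
Variables (n d : nat) (K : numClosedFieldType).
Local Notation N := (num_coefs n.+1 d.+1).
Variable Res : {mpoly int[N]}.
Hypothesis hRes : is_resultant K Res.
Local Notation ResK := (map_mpoly (intr : int -> K) Res).
Local Notation T := {mpoly K[N]}.

Lemma resultant_prime : rprime ResK.
Proof.
have [_ _ [p0 pu pI]] := hRes.
exact: factorial_irr_prime (@factorial_mpoly N K) p0 pu pI.
Qed.

Let gen : 'I_n.+1 -> {mpoly T[n.+1]} := forms (fun c => 'X_c).
Let mac j : T := macaulay d j gen.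

Lemma meval_mac j u : (mac j).@[u] = macaulay d j (forms u).
Proof.
rewrite rmorph_macaulay; apply: eq_macaulay => i; rewrite map_forms.
by apply: eq_bigr => m _ /=; rewrite mevalXU.
Qed.

Lemma mac_neq0 j : mac j != 0.
Proof.
pose P (i : 'I_n.+1) : {mpoly K[n.+1]} := 'X_i ^+ d.+1.
suff : (mac j).@[coefs P] = 1.
  by move=> e; apply: contra_eq_neq e => ->; rewrite meval0 eq_sym oner_neq0.
rewrite meval_mac -[RHS](macaulay_powers d K j); apply: eq_macaulay.
by apply: forms_coefs => i; rewrite /P mpolyXn dhomogX /= mdegMn mdeg1 mul1n.
Qed.

Lemma resultant_dvd_mac j : rdvd ResK (mac j).
Proof.
apply: prime_zeros_dvd resultant_prime _ => u resu.
have [zeros _ _] := hRes; rewrite meval_mac.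
have [|v [i vi] Fv] := (zeros (forms u) (forms_dhomog u)).1.
  by rewrite subst_coefs_meval -[RHS]resu; apply: meval_eq; apply: coefs_forms.
by apply: (@macaulay_common_zero _ _ _ j _ v) => //; [exact: forms_dhomog | exists i].
Qed.

Lemma group_scale_mac j :
  group_scale j (mac j) = mac j *: 'X^#|[set a | row_form (d := d) j a == j]|.
Proof.
have e1 := rmorph_macaulay d (group_scale j : {rmorphism T -> {poly T}}) j gen.
have e2 := rmorph_macaulay d (polyC : {rmorphism T -> {poly T}}) j gen.
apply: etrans e1 _; rewrite -mul_polyC mulrC e2 -macaulay_scale.
apply: eq_macaulay => i.
rewrite map_forms /scale_form map_forms scaler_sumr; apply: eq_bigr => m _ /=.
by rewrite group_scaleXU scalerA /group_factor enum_rankK.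
Qed.

(** After [group_scale], [ResK] divides a monomial in the new variable, so it is r times a power
    ['X^b]; setting this variable to 1 identifies r with [ResK]. *)
Lemma resultant_scale1 j : exists2 b, (b <= d.+1 ^ n)%N &
  forall s (F : 'I_n.+1 -> {mpoly K[n.+1]}),
    subst_coefs Res (scale_form j s F) = s ^+ b * subst_coefs Res F.
Proof.
have [H macE] := resultant_dvd_mac j.
have := congr1 (group_scale j) macE; rewrite rmorphM group_scale_mac => /esym.
case/(monomial_divisor (mac_neq0 j)) => r [b [ba resE]].
exists b; first exact: leq_trans ba (card_row_form d j).
have resU u s : ResK.@[fun c => group_factor j s c * u c] = r.@[u] * s ^+ b.
  rewrite -horner_group_scale [group_scale _ _]resE -mul_polyC rmorphM /= map_polyC map_polyXn.
  by rewrite hornerM hornerC hornerXn.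
have resu u : r.@[u] = ResK.@[u].
  have := resU u 1; rewrite expr1n mulr1 => <-; apply: meval_eq => c.
  by rewrite /group_factor if_same mul1r.
move=> s F; rewrite !subst_coefs_meval [RHS]mulrC -(resu (coefs F)) -resU; apply: meval_eq => c.
by rewrite /coefs /scale_form mcoeffZ.
Qed.

End ResultantDegree.

(** Distinct a give distinct polynomials in t, and t only has to avoid the roots of their finitely
    many differences. *)
Lemma separating_powers (K : numDomainType) (n d : nat) : exists t : K,
  injective (fun a : {ffun 'I_n -> 'I_d} => \sum_(i < n) (a i)%:R * t ^+ i).
Proof.
pose P (a : {ffun 'I_n -> 'I_d}) : {poly K} := \sum_(i < n) (a i)%:R *: 'X^i.
have Pcoef a (k : 'I_n) : (P a)`_k = (a k)%:R.
  by rewrite coef_sumMXn (big_pred1 k).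
have Peval a t : (P a).[t] = \sum_(i < n) (a i)%:R * t ^+ i.
  by rewrite horner_sum; apply: eq_bigr => i _; rewrite !hornerE.
have Pi : injective P.
  move=> a b /polyP ab; apply/ffunP => k; apply: val_inj.
  by apply/eqP; have /eqP := ab k; rewrite !Pcoef eqr_nat.
have : \prod_(ab : {ffun 'I_n -> 'I_d} * {ffun 'I_n -> 'I_d} | ab.1 != ab.2)
    (P ab.1 - P ab.2) != 0.
  by apply/prodf_neq0 => -[a b] /= ab; rewrite subr_eq0 (inj_eq Pi).
case/poly_nonroot => t; rewrite horner_prod => /prodf_neq0 tP; exists t%:R => a b ab.
apply/eqP; apply: contraT => nab; have := tP (a, b) nab.
by rewrite /= hornerD hornerN subr_eq0 !Peval ab eqxx.
Qed.

(* For i != j the form of index i has the zeros x_i = 0, x_j, ..., d * x_j,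
   so that, on the (d.+1)^n common zeros of these forms with x_j = 1, the form
   of index j is an affine function of alpha and beta. *)
Section TestSystem.
Variables (n d : nat) (j : 'I_n.+1).

Definition test_system (S : comNzRingType) (alpha beta t : S) (i : 'I_n.+1) :
    {mpoly S[n.+1]} :=
  if i == j then
    'X_j ^+ d * (alpha *: (\sum_(k < n) t ^+ k *: 'X_(lift j k)) - beta *: 'X_j)
  else \prod_(a < d.+1) ('X_i - (a : nat)%:R *: 'X_j).

Lemma test_system_dhomog (S : comNzRingType) (alpha beta t : S) i :
  test_system alpha beta t i \is d.+1.-homog.
Proof.
have X1 k : ('X_k : {mpoly S[n.+1]}) \is 1.-homog by rewrite dhomogX /= mdeg1.
rewrite /test_system; case: ifP => _.
  rewrite -[X in X.-homog]addn1; apply: dhomogM.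
    by rewrite mpolyXn dhomogX /= mdegMn mdeg1 mul1n.
  rewrite rpredB ?dhomogZ //; apply: rpred_sum => k _; exact: dhomogZ.
elim: d.+1 => [|m IH]; first by rewrite big_ord0 dhomog1.
by rewrite big_ord_recr -[X in X.-homog]addn1 dhomogM ?rpredB ?dhomogZ.
Qed.

Lemma map_test_system (S S' : comNzRingType) (f : {rmorphism S -> S'}) (alpha beta t : S) i :
  map_mpoly f (test_system alpha beta t i) = test_system (f alpha) (f beta) (f t) i.
Proof.
rewrite /test_system; case: ifP => _.
  rewrite rmorphM rmorphXn rmorphB /= !map_mpolyZ !map_mpolyX; congr (_ * (_ *: _ - _)).
  rewrite (raddf_sum (map_mpoly f)); apply: eq_bigr => k _ /=.
  by rewrite map_mpolyZ map_mpolyX rmorphXn.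
rewrite rmorph_prod; apply: eq_bigr => a _.
by rewrite rmorphB /= map_mpolyZ !map_mpolyX rmorph_nat.
Qed.

Lemma scale_test_system (S : comNzRingType) (s alpha beta t : S) i :
  scale_form j s (test_system alpha beta t) i = test_system (s * alpha) (s * beta) t i.
Proof.
rewrite /scale_form /test_system; case: ifP => _; last by rewrite scale1r.
by rewrite -!scalerA -scalerBr scalerAr.
Qed.

End TestSystem.

Section ResultantHomogeneous.
Variables (n d : nat) (K : numClosedFieldType).
Local Notation N := (num_coefs n.+1 d.+1).
Variable Res : {mpoly int[N]}.
Hypothesis hRes : is_resultant K Res.

(** As a polynomial in beta, the resultant vanishes exactly where beta is one of the (d.+1)^n
    distinct values [ell a]: elsewhere the system has no nontrivial zero. It is therefore nonzero
    with that many roots. *)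
Lemma resultant_test_system j t :
  injective (fun a : {ffun 'I_n -> 'I_d.+1} => \sum_(i < n) (a i)%:R * t ^+ i) ->
  (d.+1 ^ n < size (subst_coefs Res (test_system d j 1 'X (t%:P : {poly K}))))%N.
Proof.
pose ell (a : {ffun 'I_n -> 'I_d.+1}) : K := \sum_(i < n) (a i)%:R * t ^+ i.
move=> ell_inj; set p := subst_coefs _ _.
have pE s : p.[s] = subst_coefs Res (test_system d j 1 s t).
  rewrite -horner_evalE rmorph_subst_coefs; apply: eq_subst_coefs => i.
  by rewrite map_test_system rmorph1 /= !horner_evalE hornerX hornerC.
have [zeros _ _] := hRes.
have {}zeros s := zeros _ (test_system_dhomog d j 1 s t).
have root_ell a : p.[ell a] = 0.
  rewrite pE; apply/zeros.
  pose v i : K := if unlift j i is Some k then (a k)%:R else 1.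
  have vj : v j = 1 by rewrite /v unlift_none.
  have vl k : v (lift j k) = (a k)%:R by rewrite /v liftK.
  exists v => [|i]; first by exists j; rewrite vj oner_neq0.
  rewrite /test_system; case: eqP => [_|/eqP ij].
    rewrite mevalM mevalB !mevalZ mevalXU vj (raddf_sum (meval v)) /=.
    rewrite mulr1 mul1r [X in X - _](_ : _ = ell a) ?subrr ?mulr0 //.
    by apply: eq_bigr => k _; rewrite mevalZ mevalXU vl mulrC.
  case: (unliftP j i) ij => [k ->|->]; last by rewrite eqxx.
  move=> _; rewrite rmorph_prod (bigD1 (a k)) //= mevalB mevalZ !mevalXU vj vl.
  by rewrite mulr1 subrr mul0r.
have p0 : p != 0.
  have : \prod_(a : {ffun 'I_n -> 'I_d.+1}) ('X - (ell a)%:P) != 0.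
    by apply/prodf_neq0 => a _; rewrite polyXsubC_eq0.
  case/poly_nonroot => s; rewrite horner_prod => /prodf_neq0 sP.
  suff : p.[s%:R] != 0 by apply: contraNneq => ->; rewrite horner0.
  apply/eqP; rewrite pE => /zeros[v [i0 vi0] vP].
  (* If x_j = 0, every form of index i != j reduces to a power of x_i, so the whole vector would be
     zero. *)
  have vj : v j != 0.
    apply: contra vi0 => /eqP vj; have [->|ij] := eqVneq i0 j; first exact/eqP.
    have := vP i0; rewrite /test_system (negPf ij) rmorph_prod => /eqP.
    rewrite prodf_seq_eq0 => /hasP[a _]; rewrite /= mevalB mevalZ !mevalXU vj.
    by rewrite mulr0 subr0.
  have /fin_all_exists[a aP] : forall k : 'I_n, exists a : 'I_d.+1, v (lift j k) = a%:R * v j.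
    move=> k; have := vP (lift j k); rewrite /test_system eq_sym (negPf (neq_lift _ _)).
    rewrite rmorph_prod => /eqP; rewrite prodf_seq_eq0 => /hasP[a _].
    by rewrite /= mevalB mevalZ !mevalXU subr_eq0 => /eqP ?; exists a.
  have := vP j; rewrite /test_system eqxx mevalM rmorphXn mevalB !mevalZ mevalXU (raddf_sum (meval v)) /=.
  move/eqP; rewrite mevalXU mulf_eq0 expf_eq0 (negPf vj) andbF /= mul1r.
  rewrite [X in X - _](_ : _ = ell [ffun k => a k] * v j); last first.
    rewrite mulr_suml; apply: eq_bigr => k _.
    by rewrite mevalZ mevalXU aP ffunE mulrCA mulrA.
  rewrite -mulrBl mulf_eq0 (negPf vj) orbF.
  by have := sP [ffun k => a k] isT; rewrite !hornerE subr_eq0 eq_sym -subr_eq0 => /negPf ->.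
have /max_poly_roots : all (root p) [seq ell a | a : {ffun 'I_n -> 'I_d.+1}].
  by apply/allP => _ /mapP[a _ ->]; rewrite /root root_ell.
rewrite size_map -cardE card_ffun !card_ord; apply=> //.
by rewrite map_inj_uniq ?enum_uniq.
Qed.

(** Scaling the form j by r moves the parameters (1, 1/r) to (r, 1). Thus the resultant as a
    polynomial in beta is the reversal in degree b of the one in alpha, and its many roots force b
    to reach the upper bound. *)
Lemma resultant_scale j s (F : 'I_n.+1 -> {mpoly K[n.+1]}) :
  subst_coefs Res (scale_form j s F) = s ^+ (d.+1 ^ n) * subst_coefs Res F.
Proof.
have [b bD scaleb] := resultant_scale1 hRes j.
suff -> : (d.+1 ^ n = b)%N by apply: scaleb.
apply/eqP; rewrite eqn_leq bD andbT -ltnS.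
have [t t_inj] := separating_powers K n d.+1.
apply: leq_trans (resultant_test_system j t_inj) _.
pose p := subst_coefs Res (test_system d j 1 'X (t%:P : {poly K})).
pose q := subst_coefs Res (test_system d j 'X 1 (t%:P : {poly K})).
suff pq r : r != 0 -> r ^+ b * p.[r^-1] = q.[r] by case: (reverse_horner pq).
move=> r0; rewrite -!horner_evalE !rmorph_subst_coefs -scaleb.
apply: eq_subst_coefs => i; rewrite /scale_form !map_test_system rmorph1 /= !horner_evalE.
rewrite !hornerX !hornerC -/(scale_form j r (test_system d j 1 r^-1 t) i).
by rewrite scale_test_system mulr1 mulfV.
Qed.

(** The forms are scaled one after another; m counts those already scaled. *)
Lemma resultant_homogeneous s (F : 'I_n.+1 -> {mpoly K[n.+1]}) :
  subst_coefs Res (fun i => s *: F i) = s ^+ (n.+1 * d.+1 ^ n) * subst_coefs Res F.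
Proof.
suff H m : (m <= n.+1)%N -> subst_coefs Res (fun i : 'I_n.+1 => (if (i < m)%N then s else 1) *: F i) =
    s ^+ (m * d.+1 ^ n) * subst_coefs Res F.
  rewrite -H //; apply: eq_subst_coefs => i; by rewrite ltn_ord.
elim: m => [_|m IH mn].
  by rewrite mul0n mul1r; apply: eq_subst_coefs => i; rewrite scale1r.
rewrite mulSn exprD -mulrA -IH ?(ltnW mn) // -(resultant_scale (Ordinal mn)).
apply: eq_subst_coefs => i; rewrite /scale_form scalerA ltnS leq_eqVlt -val_eqE /=.
by case: eqP => [->|_] /=; rewrite ?ltnn ?mulr1 ?mul1r.
Qed.

End ResultantHomogeneous.

(** * The characteristic polynomial of a hypermatrix *)

Section HypermatrixForms.
Variables (k n : nat).

Lemma eq_hm_form (S : comNzRingType) (B C : hypermatrix S k n) :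
  B =1 C -> hm_form B =1 hm_form C.
Proof. by move=> BC i; apply: eq_bigr => I _; rewrite BC. Qed.

Lemma map_hm_form (S S' : comNzRingType) (f : {rmorphism S -> S'}) (B : hypermatrix S k n) i :
  map_mpoly f (hm_form B i) = hm_form (fun I => f (B I)) i.
Proof.
rewrite /hm_form (raddf_sum (map_mpoly f)); apply: eq_bigr => I _ /=.
rewrite map_mpolyZ rmorph_prod; congr (_ *: _).
by apply: eq_bigr => j _; rewrite /= map_mpolyX.
Qed.

Lemma scale_hm_form (S : comNzRingType) c (B : hypermatrix S k n) i :
  c *: hm_form B i = hm_form (fun I => c * B I) i.
Proof. by rewrite /hm_form scaler_sumr; apply: eq_bigr => I _; rewrite scalerA. Qed.

Lemma rmorph_hm_char_poly (Res : {mpoly int[num_coefs n k.-1]})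
    (S S' : comNzRingType) (f : {rmorphism S -> S'}) (A : hypermatrix S k n) :
  map_poly f (hm_char_poly Res A) = hm_char_poly Res (fun I => f (A I)).
Proof.
have e := rmorph_subst_coefs Res (map_poly f : {rmorphism {poly S} -> {poly S'}}).
apply: etrans (e _) _; apply: eq_subst_coefs => i.
rewrite map_hm_form; apply: eq_hm_form => I.
by rewrite rmorphB rmorphM /= map_polyX map_polyC /id_hm rmorph_nat.
Qed.

End HypermatrixForms.

Lemma hm_form_id (S : comNzRingType) k n (i : 'I_n) :
  hm_form (id_hm S (k := k.+1) (n := n)) i = 'X_i ^+ k.
Proof.
rewrite /hm_form (bigD1 [tuple of nseq k.+1 i]) //= /id_hm /= all_pred1_nseq scale1r.
rewrite big_nseq iter_mulr mulr1 big1 ?addr0 // => -[[|x s] //= sz] /andP[/eqP[xi] ne]; subst x.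
case: (boolP (all (pred1 i) s)) => h; last by rewrite scale0r.
case/eqP: ne; apply: val_inj => /=; congr cons.
by move/all_pred1P: h => ->; move: sz; rewrite eqSS => /eqP ->.
Qed.

(** With q(s) = det(I - sA), homogeneity gives s^D p(1/s) = q(s). So the coefficient of p at D is
    q(0) = det(I), which the normalization of the resultant makes 1. *)
Lemma hm_char_poly_monic (n d : nat) (K : numClosedFieldType)
    (Res : {mpoly int[num_coefs n.+1 d.+1]}) (A : hypermatrix K d.+2 n.+1) :
  is_resultant K Res ->
  hm_char_poly (k := d.+2) Res A \is monic /\
  size (hm_char_poly (k := d.+2) Res A) = (n.+1 * d.+1 ^ n).+1.
Proof.
move=> hRes; set D := (n.+1 * _)%N; set p := hm_char_poly _ _.
pose q := subst_coefs (d := d.+1) Res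
  (hm_form (k := d.+2) (fun I => id_hm {poly K} I - 'X * (A I)%:P)).
have pq s : s != 0 -> s ^+ D * p.[s^-1] = q.[s].
  move=> s0; rewrite -!horner_evalE /p /q /hm_char_poly /hyperdet !rmorph_subst_coefs.
  rewrite -(resultant_homogeneous hRes); apply: eq_subst_coefs => i.
  rewrite !map_hm_form scale_hm_form; apply: eq_hm_form => I.
  by rewrite /= !horner_evalE !hornerE /id_hm -!polyC_natr !hornerC mulrBr mulrA mulfV // mul1r.
have q0 : q`_0 = 1.
  have [_ one _] := hRes.
  rewrite -horner_coef0 -horner_evalE /q rmorph_subst_coefs.
  have e := congr1 (intr : int -> K) one.
  rewrite -[RHS]e rmorph_subst_coefs; apply: eq_subst_coefs => i.
  rewrite map_hm_form mpolyXn map_mpolyX -mpolyXn -hm_form_id; apply: eq_hm_form => I.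
  by rewrite /= horner_evalE !hornerE /id_hm -!polyC_natr !hornerC ?mul0r ?subr0.
have [szp pD] := reverse_horner pq.
have szE : size p = D.+1.
  apply/eqP; rewrite eqn_leq szp ltnNge; apply/negP => le.
  by have := oner_neq0 K; rewrite -q0 -pD nth_default ?eqxx.
by split=> //; rewrite monicE lead_coefE szE pD q0.
Qed.

End Resultants.

Module AnalyticRoots.
Import separable all_classical reals topology normedtype sequences derive realfun exp.
Import numFieldNormedType.Exports Resultants.
Local Open Scope classical_set_scope.

(** * The ring of analytic functions on [0, 1] *)

Section PowerSeries.
Variable R : realType.
Implicit Types (c d : nat -> R) (rho w z q : R).

(* The power series with coefficients c has radius of convergence at least rho. *)
Definition ps_bound c rho :=
  forall w, 0 < w < rho -> exists B, forall i, `|c i| * w ^+ i <= B.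

(** Bernoulli's inequality for 1/q, with the minimum with 1 covering i = 0. It absorbs the factors
    i.+1 that come from differentiation and from Cauchy products. *)
Lemma succ_geometric_bound q : 0 <= q < 1 ->
  exists M, forall i, i.+1%:R * q ^+ i <= M.
Proof.
move=> /andP[]; rewrite le_eqVlt => /predU1P[<-|q0] q1.
  exists 1 => -[|i]; first by rewrite expr0 mulr1.
  by rewrite exprS mul0r mulr0.
pose m := Num.min 1 (q^-1 - 1).
have m0 : 0 < m by rewrite lt_min ltr01 subr_gt0 invf_gt1.
have m1 : m <= 1 by rewrite ge_min lexx.
have mq : m <= q^-1 - 1 by rewrite ge_min lexx orbT.
have H i : i.+1%:R * m <= q^-1 ^+ i /\ 1 <= q^-1 ^+ i.
  elim: i => [|i [IH1 IH2]]; first by rewrite expr0 mul1r.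
  split; last by rewrite exprn_ege1 // ltW // invf_gt1.
  rewrite exprS -natr1 mulrDl mul1r.
  have : m <= (q^-1 - 1) * q^-1 ^+ i by apply: (le_trans mq); rewrite ler_peMr // subr_ge0 ltW // invf_gt1.
  move: IH1; rewrite mulrBl mul1r; set a := _ * m; set b := _ ^+ i; lra.
exists m^-1 => i; have [Hi _] := H i.
rewrite -ler_pdivlMr ?exprn_gt0 // -(ler_pM2r m0) mulrAC mulVf ?gt_eqF // mul1r.
by rewrite -exprVn.
Qed.

Lemma ps_bound_le c rho rho' : rho' <= rho -> ps_bound c rho -> ps_bound c rho'.
Proof.
move=> le b w /andP[w0 wr]; apply: b; rewrite w0 /=; exact: lt_le_trans wr le.
Qed.

Lemma ps_bound_cvg c rho z : ps_bound c rho -> `|z| < rho -> cvgn (pseries c z).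
Proof.
move=> cb zr; have [w /andP[zw wr]] : exists w, `|z| < w < rho.
  by exists ((`|z| + rho) / 2); rewrite !(midf_lt zr).
have w0 : 0 < w by exact: le_lt_trans zw.
have [|B cB] := cb w; first by rewrite w0.
have B0 : 0 <= B by have := cB 0; rewrite expr0 mulr1; exact: le_trans.
apply: normed_cvg; apply: (@series_le_cvg _ _ (geometric B (`|z| / w))) => [i|i|i|].
- exact: normr_ge0.
- by apply: geometric_ge0; rewrite // divr_ge0 // ltW.
- rewrite /= normrM normrX expr_div_n.
  rewrite [leLHS](_ : _ = (`|c i| * w ^+ i) * (`|z| ^+ i / w ^+ i)); last first.
    by field; rewrite expf_neq0 ?gt_eqF.
  by rewrite ler_wpM2r // divr_ge0 ?exprn_ge0 // ltW.
- apply: is_cvg_geometric_series; rewrite ger0_norm ?ltr_pdivrMr ?mul1r //.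
  by rewrite divr_ge0 // ltW.
Qed.

Lemma cvg_ps_bound c z : cvgn (pseries c z) -> ps_bound c `|z|.
Proof.
move=> cz w /andP[w0 wz].
have : cvgn (pseries c w) by apply: is_cvg_pseries_inside cz _; rewrite gtr0_norm.
move=> /cvg_series_bounded[K [Kreal Kf]]; exists (`|K| + 1) => i.
rewrite -[w ^+ i]gtr0_norm ?exprn_gt0 // -normrM; apply: Kf => //.
by rewrite (le_lt_trans (ler_norm K)) // ltrDl.
Qed.

(** Comparison at a radius v between w and rho: the ratio (w/v)^i outweighs the factor i.+1. *)
Lemma ps_bound_diffs c rho : ps_bound c rho -> ps_bound (pseries_diffs c) rho.
Proof.
move=> cb w /andP[w0 wr]; pose v := (w + rho) / 2.
have [wv vr] : w < v /\ v < rho by split; rewrite /v (midf_lt wr).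
have v0 : 0 < v by exact: lt_trans wv.
have [|B cB] := cb v; first by rewrite v0.
have [|M qM] := @succ_geometric_bound (w / v).
  by rewrite divr_ge0 ?ltW //= ltr_pdivrMr // mul1r.
exists (M * B / v) => i.
rewrite /pseries_diffs normrM ger0_norm ?ler0n // mulrAC.
rewrite [leLHS](_ : _ = (i.+1%:R * (w / v) ^+ i) * (`|c i.+1| * v ^+ i.+1) / v); last first.
  by rewrite expr_div_n exprS; field; rewrite expf_neq0 ?gt_eqF.
rewrite ler_wpM2r ?invr_ge0 ?(ltW v0) //.
apply: ler_pM => //.
  by apply: mulr_ge0; rewrite ?ler0n // exprn_ge0 // divr_ge0 // ltW.
by rewrite mulr_ge0 // exprn_ge0 // ltW.
Qed.

Lemma pseries_is_derive c rho z : ps_bound c rho -> `|z| < rho ->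
  is_derive z 1 (fun x => limn (pseries c x)) (limn (pseries (pseries_diffs c) z)).
Proof.
move=> cb zr; have [w /andP[zw wr]] : exists w, `|z| < w < rho.
  by exists ((`|z| + rho) / 2); rewrite !(midf_lt zr).
have w0 : 0 < w by exact: le_lt_trans zw.
have wE : `|w| = w by rewrite gtr0_norm.
apply: (@pseries_snd_diffs _ _ w); rewrite ?wE //.
- by apply: (ps_bound_cvg cb); rewrite wE.
- by apply: (ps_bound_cvg (ps_bound_diffs cb)); rewrite wE.
- by apply: (ps_bound_cvg (ps_bound_diffs (ps_bound_diffs cb))); rewrite wE.
Qed.

Lemma ps_boundD c d rho : ps_bound c rho -> ps_bound d rho ->
  ps_bound (fun i => c i + d i) rho.
Proof.
move=> cb db w wr; have [B cB] := cb w wr; have [D dD] := db w wr.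
have /andP[w0 _] := wr.
exists (B + D) => i; apply: le_trans (lerD (cB i) (dD i)).
by rewrite -mulrDl ler_wpM2r ?exprn_ge0 ?(ltW w0) // ler_normD.
Qed.

Lemma ps_boundN c rho : ps_bound c rho -> ps_bound (fun i => - c i) rho.
Proof. by move=> cb w /cb[B cB]; exists B => i; rewrite normrN. Qed.

Definition cauchy_prod c d k := \sum_(i < k.+1) c i * d (k - i)%N.

Lemma cauchy_prod_norm c d w B D k : 0 <= w ->
  (forall i, `|c i| * w ^+ i <= B) -> (forall i, `|d i| * w ^+ i <= D) ->
  (\sum_(i < k.+1) `|c i| * `|d (k - i)%N|) * w ^+ k <= k.+1%:R * (B * D).
Proof.
move=> w0 cB dD; rewrite mulr_suml.
have -> : k.+1%:R * (B * D) = \sum_(i < k.+1) B * D by rewrite sumr_const card_ord mulr_natl.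
apply: ler_sum => i _.
have ik : (i <= k)%N by rewrite -ltnS.
rewrite -[in w ^+ k](subnKC ik) exprD mulrACA ler_pM ?mulr_ge0 ?exprn_ge0 //.
Qed.

Lemma ps_bound_cauchy_prod c d rho : ps_bound c rho -> ps_bound d rho ->
  ps_bound (cauchy_prod c d) rho.
Proof.
move=> cb db w /andP[w0 wr]; pose v := (w + rho) / 2.
have [wv vr] : w < v /\ v < rho by split; rewrite /v (midf_lt wr).
have v0 : 0 < v by exact: lt_trans wv.
have [|B cB] := cb v; first by rewrite v0.
have [|D dD] := db v; first by rewrite v0.
have [|M qM] := @succ_geometric_bound (w / v).
  by rewrite divr_ge0 ?ltW //= ltr_pdivrMr // mul1r.
have BD0 : 0 <= B * D.
  by apply: mulr_ge0; [apply: le_trans (cB 0) | apply: le_trans (dD 0)]; rewrite expr0 mulr1.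
exists (M * (B * D)) => k.
have le1 : `|cauchy_prod c d k| <= \sum_(i < k.+1) `|c i| * `|d (k - i)%N|.
  apply: le_trans (ler_norm_sum _ _ _) _; apply: ler_sum => i _.
  by rewrite normrM.
apply: le_trans (ler_wpM2r _ le1) _; first by rewrite exprn_ge0 ?ltW.
set S := \sum_(_ < _) _.
have -> : S * w ^+ k = S * v ^+ k * (w / v) ^+ k.
  by rewrite -mulrA -exprMn mulrCA mulfV ?mulr1 // gt_eqF.
have le2 := cauchy_prod_norm k (ltW v0) cB dD.
have q0 : 0 <= (w / v) ^+ k by rewrite exprn_ge0 // divr_ge0 // ltW.
apply: le_trans (ler_wpM2r q0 le2) _.
by rewrite mulrAC ler_wpM2r.
Qed.

End PowerSeries.

Section CauchyProduct.
Variable R : realType.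
Implicit Types (c d : nat -> R) (rho w z q : R).

Lemma pseries_poly c z N : pseries c z N = (\poly_(i < N) c i).[z].
Proof. by rewrite /pseries /series /= big_mkord horner_poly. Qed.

(** The product of two partial sums is a value of the polynomial [P N * Q N]. Its coefficients below
    N are those of the Cauchy product; the others, of index below 2N, contribute at most a geometric
    tail. *)
Lemma cvg_cauchy_prod c d rho z (a b : R) : ps_bound c rho -> ps_bound d rho -> `|z| < rho ->
  pseries c z @ \oo --> a -> pseries d z @ \oo --> b ->
  pseries (cauchy_prod c d) z @ \oo --> a * b.
Proof.
move=> cb db zr ca dbb; have [v /andP[zv vr]] : exists v, `|z| < v < rho.
  by exists ((`|z| + rho) / 2); rewrite !(midf_lt zr).
have v0 : 0 < v by exact: le_lt_trans zv.
have [|B cB] := cb v; first by rewrite v0.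
have [|D dD] := db v; first by rewrite v0.
have BD0 : 0 <= B * D.
  by apply: mulr_ge0; [apply: le_trans (cB 0) | apply: le_trans (dD 0)]; rewrite expr0 mulr1.
pose q := `|z| / v.
have q0 : 0 <= q by rewrite divr_ge0 // ltW.
have q1 : q < 1 by rewrite ltr_pdivrMr // mul1r.
(* Room between q and r absorbs the factor k.+1, and r < 1 makes the tails vanish. *)
pose r := (q + 1) / 2.
have [qr r1] : q < r /\ r < 1 by split; rewrite /r (midf_lt q1).
have r0 : 0 < r by exact: le_lt_trans qr.
have [|M qM] := @succ_geometric_bound _ (q / r).
  by rewrite divr_ge0 ?(ltW r0) //= ltr_pdivrMr // mul1r.
have M0 : 0 <= M by have := qM 0; rewrite expr0 mulr1; apply: le_trans.
pose P N : {poly R} := \poly_(i < N) c i; pose Q N : {poly R} := \poly_(i < N) d i.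
have PQ N k : `|(P N * Q N)`_k * z ^+ k| <= B * D * M * r ^+ k.
  have le1 : `|(P N * Q N)`_k| <= \sum_(i < k.+1) `|c i| * `|d (k - i)%N|.
    rewrite coefM; apply: le_trans (ler_norm_sum _ _ _) _; apply: ler_sum => i _.
    rewrite normrM !coef_poly ler_pM //; case: ifP => _; rewrite ?normr0 //.
  have le2 := cauchy_prod_norm k (ltW v0) cB dD.
  rewrite normrM normrX; apply: (@le_trans _ _ (k.+1%:R * (B * D) * q ^+ k)).
    apply: le_trans (ler_wpM2r (exprn_ge0 k q0) le2).
    rewrite -mulrA -exprMn /q mulrCA mulfV ?mulr1 ?gt_eqF //.
    by rewrite ler_wpM2r ?exprn_ge0.
  have -> : k.+1%:R * (B * D) * q ^+ k = B * D * (k.+1%:R * (q / r) ^+ k) * r ^+ k.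
    have -> : q ^+ k = (q / r) ^+ k * r ^+ k by rewrite -exprMn divfK // gt_eqF.
    by ring.
  by rewrite ler_wpM2r ?exprn_ge0 ?(ltW r0) // ler_wpM2l.
have tail N : `|pseries c z N * pseries d z N - pseries (cauchy_prod c d) z N|
    <= B * D * M / (1 - r) * r ^+ N.
  rewrite !pseries_poly -/(P N) -/(Q N) -hornerM (@horner_coef_wide _ (N + N)); last first.
    apply: leq_trans (size_polyMleq _ _) _.
    apply: leq_trans (leq_pred _) _.
    by apply: leq_add; apply: size_poly.
  rewrite -(big_mkord xpredT (fun i => (P N * Q N)`_i * z ^+ i)).
  rewrite (@big_cat_nat _ _ _ N) /= ?leq_addr // big_mkord horner_poly.
  rewrite [X in X + _ - _](_ : _ = \sum_(i < N) cauchy_prod c d i * z ^+ i); last first.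
    apply: eq_bigr => i _; rewrite coefM; congr (_ * _); apply: eq_bigr => j _.
    rewrite !coef_poly !ifT //; first exact: leq_ltn_trans (leq_subr _ _) _.
    by apply: leq_ltn_trans (ltn_ord i); rewrite -ltnS.
  rewrite addrAC subrr add0r; apply: le_trans (ler_norm_sum _ _ _) _.
  apply: (@le_trans _ _ (\sum_(N <= i < N + N) B * D * M * r ^+ i)).
    by apply: ler_sum => i _.
  rewrite -mulr_sumr geometric_partial_tail -[leRHS]mulrA [_^-1 * _]mulrC.
  apply: ler_wpM2l; first exact: mulr_ge0.
  by apply: geometric_le_lim; rewrite ?exprn_ge0 ?(ltW r0) // gtr0_norm.
have lim0 : (fun N => pseries c z N * pseries d z N - pseries (cauchy_prod c d) z N) @ \oo --> 0.
  apply/norm_cvg0P; apply: (@squeeze_cvgr _ _ _ _ (cst 0) (geometric (B * D * M / (1 - r)) r)).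
  - by apply: nearW => N; rewrite /= normr_ge0 tail.
  - exact: cvg_cst.
  - by apply: cvg_geometric; rewrite gtr0_norm.
have -> : pseries (cauchy_prod c d) z = (fun N => pseries c z N * pseries d z N -
    (pseries c z N * pseries d z N - pseries (cauchy_prod c d) z N)).
  by apply/funext => N; rewrite subKr.
rewrite -[a * b]subr0; apply: cvgB => //; exact: cvgM.
Qed.

End CauchyProduct.

(** * Propagation of locally constant properties along an interval *)

Section IntervalInduction.
Variable R : realType.

(** Connectedness: points with P and points without P are covered by balls on which P does not
    change within I, so the points with P are open and closed in I. *)
Lemma interval_propagation (I : set R) (P : R -> Prop) : is_interval I ->
  (forall u, I u -> exists2 e, 0 < e & forall v w, I v -> I w ->
     `|v - u| < e -> `|w - u| < e -> P v -> P w) ->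
  forall x y, I x -> I y -> P x -> P y.
Proof.
move=> /connected_intervalP conI loc x y Ix Iy Px.
pose good (u e : R) := 0 < e /\ forall v w, I v -> I w ->
     `|v - u| < e -> `|w - u| < e -> P v -> P w.
have goodP u : I u -> exists e, good u e by move=> /loc[e e0 h]; exists e.
pose C (Q : R -> Prop) := \bigcup_(p in [set p : R * R | [/\ I p.1, Q p.1 & good p.1 p.2]]) ball p.1 p.2.
have openC Q : open (C Q).
  by apply: bigcup_open => -[u e] [_ _ [e0 _]]; apply: ball_open.
have center u e : good u e -> `|u - u| < e by move=> [e0 _]; rewrite subrr normr0.
suff IP : [set t | I t /\ P t] = I by move: Iy; rewrite -{1}IP => -[].
apply: conI.
- by exists x.
- exists (C P) => //; apply/seteqP; split=> t /=.
    move=> [It Pt]; split=> //; have [e ge] := goodP t It.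
    by exists (t, e); [split | apply: ballxx; case: ge].
  move=> [It [[u e] [/= Iu Pu ge] /=]]; rewrite /ball /= distrC => tu; split=> //.
  by have [_ h] := ge; apply: (h u t) => //; exact: center.
- exists (~` C (fun u => ~ P u)); first exact: open_closedC.
  apply/seteqP; split=> t /=.
    move=> [It Pt]; split=> // -[[u e] [/= Iu nPu ge] /=]; rewrite /ball /= distrC => tu.
    by apply: nPu; have [_ h] := ge; apply: (h t u) => //; exact: center.
  move=> [It nC]; split=> //; apply: contrapT => nPt; apply: nC.
  have [e ge] := goodP t It.
  by exists (t, e); [split | apply: ballxx; case: ge].
Qed.

End IntervalInduction.

(** * Analytic functions on [0, 1] and their zeros *)

Section Analytic.
Variable R : realType.
Implicit Types (f g : R -> R) (t : R).

(** The value is prescribed only inside [0, 1], possibly on one side of t0; the separate bound on c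
    makes the series converge on both sides. *)
Definition analytic_at f t0 := exists c (rho : R), [/\ 0 < rho, ps_bound c rho &
  forall t, 0 <= t <= 1 -> `|t - t0| < rho -> pseries c (t - t0) @ \oo --> f t].

Definition analytic01 f := forall t, 0 <= t <= 1 -> analytic_at f t.

(** The step points to the interior. Two test points are provided so that one of them avoids a given
    exceptional point. *)
Lemma unit_interval_step t (e : R) : 0 <= t <= 1 -> 0 < e ->
  exists h, [/\ h != 0, `|h| < e, 0 <= t + h <= 1 & 0 <= t + h / 2 <= 1].
Proof.
move=> t01 e0; pose m := Num.min (e / 2) 2^-1.
have m0 : 0 < m by rewrite lt_min; lra.
have me : m < e.
  by apply: (@le_lt_trans _ _ (e / 2)); [rewrite ge_min lexx | lra].
have m2 : m <= 2^-1 by rewrite ge_min lexx orbT.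
have [th|th] := leP t 2^-1.
  exists m; split; rewrite ?gt_eqF ?gtr0_norm //; lra.
exists (- m); split; rewrite ?oppr_eq0 ?gt_eqF ?normrN ?gtr0_norm //; lra.
Qed.

(** Convergence at the single point t0 + h bounds the coefficients up to radius |h|, to which the
    radius is reduced. *)
Lemma real_analytic_analytic01 f : real_analytic_on `[0, 1] f -> analytic01 f.
Proof.
move=> fa t0 t01; have [|c [r [r0 cf]]] := fa t0; first by rewrite /= in_itv.
have [h [h0 hr th _]] := unit_interval_step t01 r0.
exists c, `|h|; split; rewrite ?normr_gt0 //.
  apply: cvg_ps_bound; have := cf (t0 + h); rewrite /= in_itv /= addrAC subrr add0r.
  by move=> /(_ th hr) /cvgP.
move=> t tt lt; apply: cf; first by rewrite /= in_itv.
exact: lt_trans lt hr.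
Qed.

Lemma pseries_const (a h : R) : pseries (fun i => if i == 0%N then a else 0) h @ \oo --> a.
Proof.
rewrite -cvg_shiftS /=.
have -> : (fun n => pseries (fun i => if i == 0%N then a else 0) h n.+1) = cst a.
  apply/funext => n; rewrite /pseries /series /= big_nat_recl // expr0 mulr1.
  by rewrite big1 ?addr0 // => i _; rewrite mul0r.
exact: cvg_cst.
Qed.

Lemma analytic01_cst (a : R) : analytic01 (fun=> a).
Proof.
move=> t0 _; exists (fun i => if i == 0%N then a else 0), 1; split=> //.
  move=> w /andP[w0 w1]; exists `|a| => -[|i] /=; first by rewrite expr0 mulr1.
  by rewrite normr0 mul0r.
by move=> t _ _; exact: pseries_const.
Qed.

Lemma analytic01N f : analytic01 f -> analytic01 (fun t => - f t).
Proof.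
move=> fa t0 t01; have [c [rho [r0 cb cf]]] := fa t0 t01.
exists (fun i => - c i), rho; split=> //; first exact: ps_boundN.
move=> t tt lt; have -> : pseries (fun i => - c i) (t - t0) = (fun N => - pseries c (t - t0) N).
  by apply/funext => N; rewrite /pseries /series /= -sumrN; apply: eq_bigr => i _; rewrite mulNr.
by apply: cvgN; exact: cf.
Qed.

Let common_radius f g t0 : analytic_at f t0 -> analytic_at g t0 ->
  exists c d (rho : R), [/\ 0 < rho, ps_bound c rho, ps_bound d rho &
    forall t, 0 <= t <= 1 -> `|t - t0| < rho ->
      pseries c (t - t0) @ \oo --> f t /\ pseries d (t - t0) @ \oo --> g t].
Proof.
move=> [c [r [r0 cb cf]]] [d [s [s0 db dg]]]; exists c, d, (Num.min r s).
split; first by rewrite lt_min r0.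
- by apply: ps_bound_le cb; rewrite ge_min lexx.
- by apply: ps_bound_le db; rewrite ge_min lexx orbT.
by move=> t tt; rewrite lt_min => /andP[tr ts]; split; [exact: cf | exact: dg].
Qed.

Lemma analytic01D f g : analytic01 f -> analytic01 g -> analytic01 (fun t => f t + g t).
Proof.
move=> fa ga t0 t01; have [c [d [rho [r0 cb db cd]]]] := common_radius (fa t0 t01) (ga t0 t01).
exists (fun i => c i + d i), rho; split=> //; first exact: ps_boundD.
move=> t tt lt; have [cf dg] := cd t tt lt.
have -> : pseries (fun i => c i + d i) (t - t0) =
    (fun N => pseries c (t - t0) N + pseries d (t - t0) N).
  apply/funext => N; rewrite /pseries /series /= -big_split.
  by apply: eq_bigr => i _; rewrite mulrDl.
exact: cvgD.
Qed.

Lemma analytic01M f g : analytic01 f -> analytic01 g -> analytic01 (fun t => f t * g t).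
Proof.
move=> fa ga t0 t01; have [c [d [rho [r0 cb db cd]]]] := common_radius (fa t0 t01) (ga t0 t01).
exists (cauchy_prod c d), rho; split=> //; first exact: ps_bound_cauchy_prod.
by move=> t tt lt; have [cf dg] := cd t tt lt; exact: (cvg_cauchy_prod cb db lt).
Qed.

(** If c_m is the first nonzero coefficient, then f(t0 + h) = h^m g(h) with g continuous at 0 and
    g(0) = c_m, so zeros are isolated. *)
Lemma analytic_dichotomy f t0 : analytic_at f t0 ->
  (exists2 e, 0 < e & forall t, 0 <= t <= 1 -> `|t - t0| < e -> f t = 0) \/
  (exists2 e, 0 < e & forall t, 0 <= t <= 1 -> t != t0 -> `|t - t0| < e -> f t != 0).
Proof.
move=> [c [rho [r0 cb cf]]].
have [c0|/existsNP[i0 /eqP ci0]] := pselect (forall i, c i = 0).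
  left; exists rho => // t tt lt; have := cf t tt lt.
  have -> : pseries c (t - t0) = cst 0.
    by apply/funext => N; rewrite /pseries /series /= big1 // => i _; rewrite c0 mul0r.
  by move=> /(cvg_lim (@Rhausdorff R)) <-; rewrite lim_cst //; exact: Rhausdorff.
right; have exm : exists m, c m != 0 by exists i0.
case: (ex_minnP exm) => m cm mmin.
have cz i : (i < m)%N -> c i = 0.
  by move=> im; apply/eqP; apply: contraTT im => /mmin; rewrite -leqNgt.
pose d i := c (i + m)%N; pose g x := limn (pseries d x).
have db : ps_bound d rho.
  move=> w wr; have [B cB] := cb w wr; have /andP[w0 _] := wr.
  exists (B / w ^+ m) => i; rewrite ler_pdivlMr ?exprn_gt0 // -mulrA -exprD.
  exact: cB.
have gd := @pseries_is_derive _ d rho 0 db; rewrite normr0 in gd.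
have gc : g x @[x --> (0 : R)] --> g 0.
  by apply/differentiable_continuous/derivable1_diffP; case: (gd r0).
have g0 : g 0 = c m.
  rewrite /g.
  have -> : pseries d 0 = pseries (fun i => if i == 0%N then c m else 0) 0.
    apply/funext => N; rewrite /pseries /series /=; apply: eq_bigr => -[|i] _ //=.
    by rewrite exprS !mul0r !mulr0.
  by apply: cvg_lim; [exact: Rhausdorff | exact: pseries_const].
have /cvgrPdist_lt/(_ `|c m|) := gc; rewrite normr_gt0 => /(_ cm).
move=> /nbhs_ballP[e /= e0 ge]; exists (Num.min e rho); first by rewrite lt_min e0.
move=> t tt tt0; rewrite lt_min => /andP[te tr].
have := cf t tt tr; set h := t - t0 in te tr *.
have h0 : h != 0 by rewrite subr_eq0.
have ch := ps_bound_cvg db tr.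
have : pseries c h @ \oo --> h ^+ m * g h.
  rewrite -(cvg_shiftn m) /=.
  have -> : (fun n => pseries c h (n + m)%N) = (fun n => h ^+ m * pseries d h n).
    apply/funext => N; rewrite /pseries /series /= addnC (@big_cat_nat _ _ _ m) ?leq_addr //=.
    rewrite big_nat_cond big1 ?add0r => [|i /andP[/andP[_ /cz ->] _]]; last by rewrite mul0r.
    rewrite -{1}[m]add0n big_addn addKn mulr_sumr; apply: eq_bigr => i _.
    by rewrite exprD mulrA mulrC mulrA.
  by apply: cvgMr.
move=> c1 c2; have -> : f t = h ^+ m * g h by apply: (cvg_unique _ c2 c1); exact: Rhausdorff.
rewrite mulf_neq0 ?expf_neq0 //; have := ge h; rewrite /ball /= sub0r normrN g0 => /(_ te).
by apply: contraTneq => ->; rewrite subr0 ltxx.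
Qed.

(** Local vanishing would propagate to t1, so every zero is isolated; finiteness of the zeros in
    [0, t] then propagates from t = 0 to t = 1. *)
Lemma analytic01_zeros f : analytic01 f -> (exists2 t, 0 <= t <= 1 & f t != 0) ->
  finite_set [set t | 0 <= t <= 1 /\ f t = 0].
Proof.
move=> fa [t1 t1I ft1].
pose P t := exists2 e, 0 < e & forall s, 0 <= s <= 1 -> `|s - t| < e -> f s = 0.
have itv01 : is_interval [set t : R | 0 <= t <= 1].
  by move=> x y /= xI yI z xyz; lra.
have center t (e : R) : 0 < e -> `|t - t| < e by rewrite subrr normr0.
have nP t : 0 <= t <= 1 -> ~ P t.
  move=> tI Pt; suff [e e0 /(_ t1 t1I)] : P t1 by rewrite center // => /(_ isT)/eqP; rewrite (negPf ft1).
  apply: (interval_propagation itv01 _ tI t1I Pt) => u uI.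
  have [[e e0 fz]|[e e0 fnz]] := analytic_dichotomy (fa u uI).
    exists e => // v w vI wI vu wu _; exists (e - `|w - u|); first by rewrite subr_gt0.
    move=> s sI sw; apply: fz => //; rewrite -(subrK w s) -addrA.
    by apply: le_lt_trans (ler_normD _ _) _; rewrite -ltrBrDr.
  exists e => // v w vI wI vu _ [e' e'0 fz].
  have [|h [h0 hm vh vh2]] := unit_interval_step (e := Num.min e' (e - `|v - u|)) vI.
    by rewrite lt_min e'0 subr_gt0.
  have small k : `|k| <= `|h| -> 0 <= v + k <= 1 -> v + k != u -> False.
    move=> kh vk vku; have kl := le_lt_trans kh hm; rewrite lt_min in kl.
    have /andP[k1 k2] := kl.
    have lt : `|v + k - u| < e.
      by rewrite addrAC addrC; apply: le_lt_trans (ler_normD _ _) _; rewrite -ltrBrDr.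
    by have := fnz _ vk vku lt; rewrite fz ?eqxx // addrAC subrr add0r.
  (* Vanishing near v is incompatible with a zero-free punctured neighbourhood of u: one of v + h
     and v + h / 2 differs from u. *)
  have [vhu|] := eqVneq (v + h) u; last by move/(small h (lexx _) vh).
  have : v + h / 2 != u.
    rewrite -vhu (inj_eq (addrI v)); apply: contra_neq h0 => hh; lra.
  move/(small (h / 2)) => []//.
  by rewrite normrM [X in _ * X]gtr0_norm ?invr_gt0 // ler_piMr // invf_le1 // ler1n.
have I0 : [set t : R | 0 <= t <= 1] 0 by rewrite /= lexx ler01.
have I1 : [set t : R | 0 <= t <= 1] 1 by rewrite /= lexx ler01.
(* Moving from v to w near u adds at most the zero u. *)
pose Q t := finite_set [set s | 0 <= s <= t /\ f s = 0].
apply: (interval_propagation (P := Q) itv01 _ I0 I1) => [u uI|]; last first.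
  apply: (sub_finite_set _ (finite_set1 0)) => s /= [s0 _].
  by apply/eqP; rewrite eq_le andbC.
have [[e e0 fz]|[e e0 fnz]] := analytic_dichotomy (fa u uI); first by case: (nP u uI); exists e.
exists e => // v w vI wI vu wu fv.
apply: (@sub_finite_set _ _ ([set s | 0 <= s <= v /\ f s = 0] `|` [set u])); last first.
  by rewrite finite_setU; split; [exact: fv | exact: finite_set1].
move=> s /= [sw fs]; have [sv|vs] := leP s v; first by left; split=> //; lra.
right; apply: contrapT => /eqP su.
have sI : 0 <= s <= 1 by move: wI => /= wI; lra.
have lt : `|s - u| < e by move: vu wu; rewrite !ltr_norml; lra.
by have := fnz s sI su lt; rewrite fs eqxx.
Qed.

End Analytic.

(** * The integral domain of analytic functions *)

Section AnalyticRing.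
Variable R : realType.

Definition clamp (t : R) : R := Num.max 0 (Num.min 1 t).

Lemma clamp_itv t : 0 <= clamp t <= 1.
Proof. by rewrite /clamp le_max lexx /= ge_max ler01 ge_min lexx. Qed.

Lemma clamp_id t : 0 <= t <= 1 -> clamp t = t.
Proof. by move=> /andP[t0 t1]; rewrite /clamp (min_r t1) (max_r t0). Qed.

(* Analytic functions on [0, 1], represented by functions on R that are
   constant on each side of [0, 1], so that equality is equality on [0, 1]. *)
Definition analytic_fun : {pred R -> R} :=
  fun f => `[< analytic01 f /\ forall t, f t = f (clamp t) >].

Lemma analytic_funP f : reflect (analytic01 f /\ forall t, f t = f (clamp t))
  (f \in analytic_fun).
Proof. exact: asboolP. Qed.

Fact analytic_fun_subring : subring_closed analytic_fun.
Proof.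
split.
- by apply/analytic_funP; split=> //; exact: analytic01_cst.
- move=> f g /analytic_funP[fa fc] /analytic_funP[ga gc]; apply/analytic_funP; split.
    by apply: analytic01D => //; exact: analytic01N.
  by move=> t; rewrite !fctE fc gc.
- move=> f g /analytic_funP[fa fc] /analytic_funP[ga gc]; apply/analytic_funP; split.
    exact: analytic01M.
  by move=> t; rewrite !fctE fc gc.
Qed.

HB.instance Definition _ := GRing.isSubringClosed.Build (R -> R) analytic_fun analytic_fun_subring.

Record anafun := AnaFun { anafun_val :> R -> R; _ : anafun_val \in analytic_fun }.

HB.instance Definition _ := [isSub for anafun_val].
HB.instance Definition _ := [Choice of anafun by <:].
HB.instance Definition _ := [SubChoice_isSubComNzRing of anafun by <:].

Implicit Types (f g : anafun).

Lemma anafunP f : analytic01 f /\ forall t, f t = f (clamp t).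
Proof. exact/analytic_funP/(valP f). Qed.

Lemma anafun_eq f g : (forall t, 0 <= t <= 1 -> f t = g t) -> f = g.
Proof.
move=> fg; apply: val_inj; apply/funext => t /=.
rewrite (anafunP f).2 (anafunP g).2; apply: fg; exact: clamp_itv.
Qed.

Lemma anafun_zeros f : f != 0 -> finite_set [set t | 0 <= t <= 1 /\ f t = 0].
Proof.
move=> f0; apply: analytic01_zeros; first exact: (anafunP f).1.
apply: contrapT => nz; case/eqP: f0; apply: anafun_eq => t t01.
by apply: contrapT => /eqP ft; apply: nz; exists t.
Qed.

Lemma unit_interval_infinite : infinite_set [set t : R | 0 <= t <= 1].
Proof.
move=> /finite_seqP[s sE]; pose r := [seq (i.+1%:R : R)^-1 | i <- iota 0 (size s).+1].
have ur : uniq r.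
  by rewrite map_inj_uniq ?iota_uniq // => i j /invr_inj/eqP; rewrite eqr_nat => /eqP[].
suff /(uniq_leq_size ur) : {subset r <= s} by rewrite size_map size_iota ltnn.
move=> _ /mapP[i _ ->]; have : [set` s] (i.+1%:R^-1) by rewrite -sE /= invr_ge0 ler0n invf_le1 ?ler1n ?ltr0n.
by [].
Qed.

Definition anafun_unit : pred anafun := fun f => `[< exists g, g * f = 1 >].
(** The default f makes inversion the identity off the units, as the ring structure demands. *)
Definition anafun_inv f := xget f [set g | g * f = 1].

Fact anafun_mulVr : {in anafun_unit, left_inverse 1 anafun_inv *%R}.
Proof. by move=> f /asboolP[g gf]; exact: (@xgetPex _ f [set g | g * f = 1] (ex_intro _ g gf)). Qed.

Fact anafun_unitP f g : g * f = 1 -> anafun_unit f.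
Proof. by move=> gf; apply/asboolP; exists g. Qed.

Fact anafun_inv_out : {in [predC anafun_unit], anafun_inv =1 id}.
Proof.
move=> f; rewrite inE /= => /asboolP nf; apply: xgetPN => g gf.
by apply: nf; exists g.
Qed.

HB.instance Definition _ :=
  GRing.ComNzRing_hasMulInverse.Build anafun anafun_mulVr anafun_unitP anafun_inv_out.

(** The zero sets of two nonzero functions are finite and cannot cover [0, 1]. *)
Fact anafun_idomain f g : f * g = 0 -> (f == 0) || (g == 0).
Proof.
move=> fg; apply: contrapT => /negP; rewrite negb_or => /andP[/anafun_zeros zf /anafun_zeros zg].
have : finite_set [set t : R | 0 <= t <= 1].
  apply: (@sub_finite_set _ _ ([set t | 0 <= t <= 1 /\ f t = 0] `|`
      [set t | 0 <= t <= 1 /\ g t = 0])); last by rewrite finite_setU.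
  move=> t t01; have /(congr1 (fun h => (h : anafun) t)) /eqP := fg.
  by rewrite [X in X == _]/(f t * g t) mulf_eq0 => /orP[]/eqP; [left | right].
exact: unit_interval_infinite.
Qed.

HB.instance Definition _ := GRing.ComUnitRing_isIntegral.Build anafun anafun_idomain.

Definition anafun_eval (t : R) f : R := f t.

Fact anafun_eval_is_zmod t : zmod_morphism (anafun_eval t).
Proof. by []. Qed.

Fact anafun_eval_is_monoid t : monoid_morphism (anafun_eval t).
Proof. by []. Qed.

HB.instance Definition _ t :=
  GRing.isZmodMorphism.Build anafun R (anafun_eval t) (anafun_eval_is_zmod t).
HB.instance Definition _ t :=
  GRing.isMonoidMorphism.Build anafun R (anafun_eval t) (anafun_eval_is_monoid t).

Lemma anafun_of (h : R -> R) : real_analytic_on `[0, 1] h ->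
  exists f, forall t, 0 <= t <= 1 -> f t = h t.
Proof.
move=> /real_analytic_analytic01 ha.
have hP : (fun t => h (clamp t)) \in analytic_fun.
  apply/analytic_funP; split; last by move=> t; rewrite (clamp_id (clamp_itv t)).
  move=> t0 t01; have [c [rho [r0 cb cf]]] := ha t0 t01.
  exists c, rho; split=> // t tI lt; rewrite clamp_id //; exact: cf.
by exists (AnaFun hP) => t tI; rewrite /= clamp_id.
Qed.

End AnalyticRing.

(** * Smooth choice of the roots *)

Section Differentiability.
Variable R : realType.
Implicit Types (U : set R) (f g : R -> R) (m : nat).

(** Only the existence of m successive derivatives is recorded, since smoothness asks for every m;
    the class is closed under arithmetic by induction on m. *)
Fixpoint cn m U f : Prop :=
  if m is m'.+1 then
    exists f', (forall t, U t -> is_derive t 1 f (f' t)) /\ cn m' U f'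
  else True.

Lemma cnW m U f : cn m.+1 U f -> cn m U f.
Proof. by elim: m f => [//|m IH] f [f' [ff' /IH]]; exists f'. Qed.

Lemma cn_sub m U V f : V `<=` U -> cn m U f -> cn m V f.
Proof.
by move=> VU; elim: m f => [//|m IH] f [f' [ff' /IH cf']]; exists f'; split=> // t /VU/ff'.
Qed.

Lemma cn_eq m U f g : open U -> (forall t, U t -> f t = g t) -> cn m U f -> cn m U g.
Proof.
move=> oU fg; case: m => [//|m] [f' [ff' cf']]; exists f'; split=> // t Ut.
apply: (near_eq_is_derive _ (ff' t Ut)).
by move/open_nbhs_nbhs: (conj oU Ut); apply: filterS => s /fg ->.
Qed.

Lemma cn_cst m U (a : R) : cn m U (fun=> a).
Proof.
elim: m a => [//|m IH] a; exists (fun=> 0); split; last exact: IH.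
by move=> t _; exact: is_derive_cst.
Qed.

Lemma cnD m U f g : cn m U f -> cn m U g -> cn m U (fun t => f t + g t).
Proof.
elim: m f g => [//|m IH] f g [f' [ff' cf']] [g' [gg' cg']].
exists (fun t => f' t + g' t); split; last exact: IH.
by move=> t Ut; apply: is_deriveD; [exact: ff' | exact: gg'].
Qed.

Lemma cnN m U f : cn m U f -> cn m U (fun t => - f t).
Proof.
elim: m f => [//|m IH] f [f' [ff' cf']].
exists (fun t => - f' t); split; last exact: IH.
by move=> t Ut; apply: is_deriveN; exact: ff'.
Qed.

Lemma cnM m U f g : cn m U f -> cn m U g -> cn m U (fun t => f t * g t).
Proof.
elim: m f g => [//|m IH] f g cf cg.
have [f' [ff' cf']] := cf; have [g' [gg' cg']] := cg.
exists (fun t => f t * g' t + g t * f' t); split.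
  by move=> t Ut; apply: is_deriveM; [exact: ff' | exact: gg'].
by apply: cnD; apply: IH => //; exact: cnW.
Qed.

Lemma cnV m U f : (forall t, U t -> f t != 0) -> cn m U f -> cn m U (fun t => (f t)^-1).
Proof.
move=> f0; elim: m f f0 => [//|m IH] f f0 cf; have [f' [ff' cf']] := cf.
exists (fun t => - ((f t)^-1 * (f t)^-1) * f' t); split.
  move=> t Ut; have := is_deriveV (f0 t Ut) (ff' t Ut).
  by rewrite expr2 invfM.
have cV := IH f f0 (cnW cf).
by apply: cnM => //; apply: cnN; apply: cnM.
Qed.

Lemma cn_derivable m U f : open U -> cn m.+1 U f ->
  forall t, U t -> derivable (derive1n m f) t 1.
Proof.
move=> oU; elim: m f => [|m IH] f [f' [ff' cf']] t Ut; first by case: (ff' t Ut).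
rewrite derive1Sn; apply: (IH _ _ t Ut); apply: (@cn_eq m.+1 U f' _ oU _ cf') => s Us.
by rewrite derive1E; case: (ff' s Us).
Qed.

Definition near_pt (t e : R) : set R := [set s | `|s - t| < e].

Lemma open_near_pt t e : open (near_pt t e).
Proof.
have [e0|e0] := leP e 0.
  rewrite (_ : near_pt t e = set0); first exact: open0.
  by apply/seteqP; split=> // s; rewrite /near_pt /= => /lt_le_trans/(_ e0); rewrite normr_lt0.
rewrite (_ : near_pt t e = ball t e); first exact: ball_open.
by apply/seteqP; split=> s; rewrite /near_pt /ball /= distrC.
Qed.

Lemma cn_smooth_at (D : set R) f t e : 0 < e -> (forall m, cn m (near_pt t e) f) ->
  smooth_at D f t.
Proof.
move=> e0 cf; exists f, e; split=> // m s st.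
exact: (cn_derivable (@open_near_pt t e) (cf m.+1) st).
Qed.

Lemma pseries_cn m c rho t0 : ps_bound c rho ->
  cn m (near_pt t0 rho) (fun t => limn (pseries c (t - t0))).
Proof.
elim: m c => [//|m IH] c cb.
exists (fun t => limn (pseries (pseries_diffs c) (t - t0))).
split; last by apply: IH; exact: ps_bound_diffs.
move=> t tt0.
have d1 : is_derive t 1 (fun s : R => s - t0) 1.
  rewrite -[X in is_derive _ _ _ X]subr0.
  exact: is_deriveB.
have d2 := pseries_is_derive cb tt0.
have := @is_derive1_comp _ (fun x => limn (pseries c x)) (fun s : R => s - t0) t _ _ d2 d1.
by rewrite mulr1.
Qed.

(** The radius is cut by t0 and 1 - t0 so that the whole neighbourhood lies where the series
    represents f. *)
Lemma analytic_cn f t0 : analytic01 f -> 0 < t0 < 1 ->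
  exists2 e, 0 < e & forall m, cn m (near_pt t0 e) f.
Proof.
move=> fa /andP[t00 t01].
have [|c [rho [r0 cb cf]]] := fa t0; first by rewrite !ltW.
exists (Num.min rho (Num.min t0 (1 - t0))); first by rewrite !lt_min r0 t00 subr_gt0.
move=> m; apply: (@cn_eq _ _ (fun t => limn (pseries c (t - t0)))).
- exact: open_near_pt.
- move=> t; rewrite /near_pt /= !lt_min => /and3P[tr tt0 tt1].
  apply: cvg_lim; first exact: Rhausdorff.
  by apply: cf => //; move: tt0 tt1; rewrite !ltr_norml; lra.
- by apply: cn_sub (pseries_cn m t0 cb) => t; rewrite /near_pt /= lt_min => /andP[].
Qed.

End Differentiability.

(** * Complex-valued functions of a real variable *)

Section ComplexFunctions.
Variable R : realType.
Local Notation C := R[i].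
Local Notation ReC := complex.Re.
Local Notation ImC := complex.Im.
Implicit Types (U : set R) (f g : R -> C) (m : nat) (z : C).

Definition ccn m U f := cn m U (fun t => ReC (f t)) /\ cn m U (fun t => ImC (f t)).

Lemma cReM z1 z2 : ReC (z1 * z2) = ReC z1 * ReC z2 - ImC z1 * ImC z2.
Proof. by case: z1 z2 => a b [c d]. Qed.
Lemma cImM z1 z2 : ImC (z1 * z2) = ReC z1 * ImC z2 + ImC z1 * ReC z2.
Proof. by case: z1 z2 => a b [c d]. Qed.

(** The squared modulus with values in R is multiplicative and polynomial in the components, so root
    estimates remain real inequalities without square roots. *)
Definition normsq z : R := ReC z ^+ 2 + ImC z ^+ 2.

Lemma normsqM z1 z2 : normsq (z1 * z2) = normsq z1 * normsq z2.
Proof. by rewrite /normsq cReM cImM; ring. Qed.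

Lemma normsq_ge0 z : 0 <= normsq z.
Proof. by rewrite addr_ge0 ?sqr_ge0. Qed.

Lemma normsq_eq0 z : (normsq z == 0) = (z == 0).
Proof.
rewrite /normsq paddr_eq0 ?sqr_ge0 // !sqrf_eq0.
by case: z => a b; rewrite eq_complex.
Qed.

Lemma normsq_gt0 z : (0 < normsq z) = (z != 0).
Proof. by rewrite lt_neqAle normsq_ge0 eq_sym normsq_eq0 andbT. Qed.

Lemma normsq1 : normsq 1 = 1.
Proof. by rewrite /normsq /= expr1n expr0n addr0. Qed.

Lemma cReV z : ReC z^-1 = ReC z / normsq z.
Proof. by case: z. Qed.
Lemma cImV z : ImC z^-1 = - ImC z / normsq z.
Proof. by case: z => a b; rewrite /= mulNr. Qed.

Lemma ccn_sub m U V f : V `<=` U -> ccn m U f -> ccn m V f.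
Proof. by move=> VU [a b]; split; exact: cn_sub VU _. Qed.

Lemma ccn_eq m U f g : open U -> (forall t, U t -> f t = g t) -> ccn m U f -> ccn m U g.
Proof. by move=> oU fg [a b]; split; [move: a | move: b]; apply: cn_eq => // t /fg ->. Qed.

Lemma ccn_cst m U z : ccn m U (fun=> z).
Proof. by split; exact: cn_cst. Qed.

Lemma ccnD m U f g : ccn m U f -> ccn m U g -> ccn m U (fun t => f t + g t).
Proof.
move=> [a b] [c d]; split.
  by under [X in cn _ _ X]funext do rewrite raddfD; exact: cnD.
by under [X in cn _ _ X]funext do rewrite raddfD; exact: cnD.
Qed.

Lemma ccnN m U f : ccn m U f -> ccn m U (fun t => - f t).
Proof.
move=> [a b]; split.
  by under [X in cn _ _ X]funext do rewrite raddfN; exact: cnN.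
by under [X in cn _ _ X]funext do rewrite raddfN; exact: cnN.
Qed.

Lemma ccnM m U f g : ccn m U f -> ccn m U g -> ccn m U (fun t => f t * g t).
Proof.
move=> [a b] [c d]; split.
  under [X in cn _ _ X]funext do rewrite cReM.
  by apply: cnD; [|apply: cnN]; exact: cnM.
under [X in cn _ _ X]funext do rewrite cImM.
by apply: cnD; exact: cnM.
Qed.

Lemma ccnX m U f k : ccn m U f -> ccn m U (fun t => f t ^+ k).
Proof.
move=> cf; elim: k => [|k IH]; first exact: ccn_cst.
by under [X in ccn _ _ X]funext do rewrite exprS; exact: ccnM.
Qed.

Lemma ccn_sum m U (I : Type) (s : seq I) (F : I -> R -> C) :
  (forall i, ccn m U (F i)) -> ccn m U (fun t => \sum_(i <- s) F i t).
Proof.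
move=> cF; elim: s => [|i s IH].
  by under [X in ccn _ _ X]funext do rewrite big_nil; exact: ccn_cst.
by under [X in ccn _ _ X]funext do rewrite big_cons; exact: ccnD.
Qed.

Lemma ccnV m U f : (forall t, U t -> f t != 0) -> ccn m U f -> ccn m U (fun t => (f t)^-1).
Proof.
move=> f0 [a b].
have cN : cn m U (fun t => (normsq (f t))^-1).
  apply: cnV => [t /f0|]; first by rewrite normsq_eq0.
  by apply: cnD; under [X in cn _ _ X]funext do rewrite expr2; exact: cnM.
split.
  by under [X in cn _ _ X]funext do rewrite cReV; exact: cnM.
by under [X in cn _ _ X]funext do rewrite cImV; apply: cnM => //; exact: cnN.
Qed.

Definition ccvg (T : Type) (F : set_system T) (f : T -> C) z :=
  (ReC (f t) @[t --> F] --> ReC z) /\ (ImC (f t) @[t --> F] --> ImC z).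

Section Limits.
Variables (T : Type) (F : set_system T).
Hypothesis FF : Filter F.
Implicit Types (u v : T -> C).

Lemma ccvg_cst z : ccvg F (fun=> z) z.
Proof. by split; exact: cvg_cst. Qed.

Lemma ccvgD u v z1 z2 : ccvg F u z1 -> ccvg F v z2 -> ccvg F (fun t => u t + v t) (z1 + z2).
Proof.
move=> [a b] [c d]; split.
  by under [X in X @ _]funext do rewrite raddfD; rewrite raddfD; exact: cvgD.
by under [X in X @ _]funext do rewrite raddfD; rewrite raddfD; exact: cvgD.
Qed.

Lemma ccvgN u z1 : ccvg F u z1 -> ccvg F (fun t => - u t) (- z1).
Proof.
move=> [a b]; split.
  by under [X in X @ _]funext do rewrite raddfN; rewrite raddfN; exact: cvgN.
by under [X in X @ _]funext do rewrite raddfN; rewrite raddfN; exact: cvgN.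
Qed.

Lemma ccvgM u v z1 z2 : ccvg F u z1 -> ccvg F v z2 -> ccvg F (fun t => u t * v t) (z1 * z2).
Proof.
move=> [a b] [c d]; split.
  under [X in X @ _]funext do rewrite cReM; rewrite cReM.
  by apply: cvgB; exact: cvgM.
under [X in X @ _]funext do rewrite cImM; rewrite cImM.
by apply: cvgD; exact: cvgM.
Qed.

Lemma ccvgX u z1 k : ccvg F u z1 -> ccvg F (fun t => u t ^+ k) (z1 ^+ k).
Proof.
move=> cu; elim: k => [|k IH]; first exact: ccvg_cst.
by under [X in ccvg _ X]funext do rewrite exprS; rewrite exprS; exact: ccvgM.
Qed.

Lemma ccvg_sum (I : Type) (s : seq I) (u : I -> T -> C) (z : I -> C) :
  (forall i, ccvg F (u i) (z i)) -> ccvg F (fun t => \sum_(i <- s) u i t) (\sum_(i <- s) z i).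
Proof.
move=> cu; elim: s => [|i s IH].
  by under [X in ccvg _ X]funext do rewrite big_nil; rewrite big_nil; exact: ccvg_cst.
by under [X in ccvg _ X]funext do rewrite big_cons; rewrite big_cons; exact: ccvgD.
Qed.

Lemma cvg_normsq u z : ccvg F u z -> normsq (u t) @[t --> F] --> normsq z.
Proof.
move=> [a b]; rewrite /normsq !expr2; under [X in X @ _]funext do rewrite !expr2.
by apply: cvgD; exact: cvgM.
Qed.

Lemma ccvgV u z : z != 0 -> ccvg F u z -> ccvg F (fun t => (u t)^-1) z^-1.
Proof.
move=> z0 cu; have [a b] := cu.
have cN : (normsq (u t))^-1 @[t --> F] --> (normsq z)^-1.
  by apply: cvgV; [rewrite normsq_eq0 | exact: cvg_normsq].
split.
  by under [X in X @ _]funext do rewrite cReV; rewrite cReV; exact: cvgM.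
under [X in X @ _]funext do rewrite cImV; rewrite cImV.
by apply: cvgM => //; exact: cvgN.
Qed.

Lemma ccvg_normsqP u z :
  (forall e : R, 0 < e -> \forall t \near F, normsq (u t - z) < e) -> ccvg F u z.
Proof.
have small (x y e : R) : 0 < e -> x ^+ 2 + y ^+ 2 < e ^+ 2 -> `|x| < e.
  move=> e0 lt; rewrite -(@ltr_pXn2r _ 2) ?nnegrE ?(ltW e0) // real_normK ?num_real //.
  by apply: le_lt_trans lt; rewrite lerDl sqr_ge0.
move=> h; split; apply/cvgrPdist_lt => e e0; have := h (e ^+ 2) (exprn_gt0 _ e0);
  apply: filterS => t; rewrite /normsq !raddfB /= distrC; first exact: small.
by rewrite addrC; exact: small.
Qed.

End Limits.

End ComplexFunctions.

Section ComplexDerivative.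
Variable R : realType.
Local Notation C := R[i].
Local Notation ReC := complex.Re.
Local Notation ImC := complex.Im.

Lemma is_derive_slope (f : R -> R) (t l : R) :
  is_derive t 1 f l <-> h^-1 * (f (h + t) - f t) @[h --> 0^'] --> l.
Proof.
have e : (fun h : R => h^-1 * (f (h + t) - f t)) =
    (fun h => h^-1 *: ((f \o shift t) (h *: (1 : R)) - f t)).
  by apply/funext => h; rewrite /= /shift /= [h *: 1]mulr1.
split=> [[df dl]|cl].
  by rewrite e -dl; exact: df.
rewrite e in cl; split; first by apply/cvg_ex; exists l.
by apply: cvg_lim => //; exact: Rhausdorff.
Qed.

Definition slope (f : R -> C) t (h : R) : C := (h^-1)%:C%C * (f (h + t) - f t).

Definition cderive (f : R -> C) t z := ccvg 0^' (slope f t) z.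

Lemma ReZ (a : R) z : ReC (a%:C%C * z) = a * ReC z.
Proof. by rewrite cReM /= mul0r subr0. Qed.
Lemma ImZ (a : R) z : ImC (a%:C%C * z) = a * ImC z.
Proof. by rewrite cImM /= mul0r addr0. Qed.

Lemma cderiveP f t z : cderive f t z <->
  is_derive t 1 (fun s => ReC (f s)) (ReC z) /\ is_derive t 1 (fun s => ImC (f s)) (ImC z).
Proof.
rewrite !is_derive_slope /cderive /ccvg /slope.
under [X in X @ _ --> ReC z]funext do rewrite ReZ raddfB.
by under [X in X @ _ --> ImC z]funext do rewrite ImZ raddfB.
Qed.

(** Merges the two real derivatives into one complex derivative, so that the formula for the
    derivative of a root can be iterated. *)
Lemma ccnS m (U : set R) f : ccn m.+1 U f <->
  exists f', (forall t, U t -> cderive f t (f' t)) /\ ccn m U f'.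
Proof.
split=> [[[r [fr cr]] [i [fi ci]]]|[f' [ff' [cr ci]]]].
  exists (fun t => (r t +i* i t)%C); split=> // t Ut; apply/cderiveP.
  by split; [exact: fr | exact: fi].
split; [exists (fun t => ReC (f' t)) | exists (fun t => ImC (f' t))]; split=> // t Ut.
  by have /cderiveP[] := ff' t Ut.
by have /cderiveP[] := ff' t Ut.
Qed.

Lemma is_derive_cvg (f : R -> R) (t l : R) : is_derive t 1 f l -> f s @[s --> t] --> f t.
Proof. by case=> df _; apply/differentiable_continuous/derivable1_diffP. Qed.

Lemma ccn_ccvg (U : set R) f t : ccn 1 U f -> U t -> ccvg (nbhs t) f (f t).
Proof.
move=> [[r [fr _]] [i [fi _]]] Ut.
by split; [have := fr t Ut | have := fi t Ut]; exact: is_derive_cvg.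
Qed.

Lemma ccvg_shift (f : R -> C) t z : ccvg (nbhs t) f z -> ccvg 0^' (fun h => f (h + t)) z.
Proof.
have ct : h + t @[h --> 0^'] --> t.
  rewrite -[X in _ --> X]add0r; apply: cvgD; last exact: cvg_cst.
  exact: cvg_within.
by move=> [a b]; split; [apply: cvg_comp ct a | apply: cvg_comp ct b].
Qed.

Lemma ccvg_near_eq T (F : set_system T) (FF : Filter F) (f g : T -> C) z :
  (\forall t \near F, f t = g t) -> ccvg F f z -> ccvg F g z.
Proof.
move=> fg [a b]; split; [apply: cvg_trans a | apply: cvg_trans b]; apply: near_eq_cvg;
  by apply: filterS fg => t ->.
Qed.

Lemma ccvg_neq0 T (F : set_system T) (FF : Filter F) (f : T -> C) z :
  z != 0 -> ccvg F f z -> \forall t \near F, f t != 0.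
Proof.
rewrite -normsq_gt0 => z0 /(@cvg_normsq _ _ _ FF) /cvgrPdist_lt/(_ _ z0).
by apply: filterS => t; apply: contraTneq => ->; rewrite /normsq /= expr0n addr0 subr0 gtr0_norm ?ltxx.
Qed.

End ComplexDerivative.

(** * Smooth roots near a point of separability *)

Section LocalRoots.
Variable R : realType.
Local Notation C := R[i].
Variables (q : nat) (p : R -> {poly C}) (J : set R).
Hypothesis size_p : forall t, J t -> size (p t) = q.+1.
Hypothesis sep_p : forall t, J t -> separable_poly (p t).
Hypothesis coef_p : forall t, J t -> exists2 e, 0 < e & near_pt t e `<=` J /\
  forall m j, ccn m (near_pt t e) (fun s => (p s)`_j).

Lemma poly_root_list t : J t -> exists s : seq C, [/\ size s = q, uniq s &
  p t = lead_coef (p t) *: \prod_(z <- s) ('X - z%:P)].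
Proof.
move=> Jt; have [s ps] := closed_field_poly_normal (p t).
have l0 : lead_coef (p t) != 0 by rewrite lead_coef_eq0 -size_poly_gt0 size_p.
exists s; split=> //.
  have := size_p Jt; rewrite ps size_scale // size_prod_XsubC; exact: succn_inj.
rewrite -(separable_prod_XsubC s); have := sep_p Jt; rewrite ps.
by apply: separable_mul_id || (rewrite -mul_polyC separable_mul => /and3P[]).
Qed.

Lemma horner_p t z : J t -> (p t).[z] = \sum_(j < q.+1) (p t)`_j * z ^+ j.
Proof. by move=> Jt; apply: horner_coef_wide; rewrite size_p. Qed.

Lemma near_pt_center (t e : R) : 0 < e -> near_pt t e t.
Proof. by rewrite /near_pt /= subrr normr0. Qed.

Lemma nbhs_near_pt (t : R) (A : set R) : nbhs t A -> exists2 e, 0 < e & near_pt t e `<=` A.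
Proof.
move=> /nbhs_ballP[e /= e0 eA]; exists e => // s st; apply: eA.
by rewrite /ball /= distrC.
Qed.

Lemma near_pt_nbhs (t e s : R) : near_pt t e s -> nbhs s (near_pt t e).
Proof. by move=> st; apply: open_nbhs_nbhs; split=> //; exact: open_near_pt. Qed.

Lemma coef_cvg t j : J t -> ccvg (nbhs t) (fun s => (p s)`_j) (p t)`_j.
Proof.
move=> /coef_p[e e0 [_ ce]]; apply: (ccn_ccvg (ce 1%N j)).
exact: near_pt_center.
Qed.

Lemma nbhs_J t : J t -> nbhs t J.
Proof.
move=> /coef_p[e e0 [eJ _]]; apply: filterS eJ _; exact/near_pt_nbhs/near_pt_center.
Qed.

(** The value of p s at z is its leading coefficient times the product of the differences to its
    roots. If all roots stayed away from z, its squared modulus would be at least L / 2 * eps^q, yet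
    it tends to 0. *)
Lemma near_root t z (eps : R) : J t -> root (p t) z -> 0 < eps ->
  \forall s \near t, exists w, root (p s) w /\ normsq (w - z) < eps.
Proof.
move=> Jt /eqP pz eps0.
have L0 : 0 < normsq (p t)`_q.
  rewrite normsq_gt0 -[q]/(q.+1.-1) -(size_p Jt) -lead_coefE lead_coef_eq0.
  by rewrite -size_poly_gt0 size_p.
set L := normsq (p t)`_q in L0.
have c1 : normsq (p s).[z] @[s --> t] --> 0.
  have -> : 0 = normsq (\sum_(j < q.+1) (p t)`_j * z ^+ j).
    by rewrite -horner_p // pz /normsq /= expr0n addr0.
  have c : ccvg (nbhs t) (fun s => \sum_(j < q.+1) (p s)`_j * z ^+ j)
      (\sum_(j < q.+1) (p t)`_j * z ^+ j).
    apply: ccvg_sum => j; apply: ccvgM; first exact: coef_cvg.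
    exact: ccvg_cst.
  apply: cvg_trans (cvg_normsq _ c); apply: near_eq_cvg.
  by apply: filterS (nbhs_J Jt) => s Js; rewrite horner_p.
have c2 : normsq (p s)`_q @[s --> t] --> L by apply: cvg_normsq; exact: coef_cvg.
have b0 : 0 < L / 2 * eps ^+ q by rewrite mulr_gt0 ?divr_gt0 ?exprn_gt0.
have L2 : 0 < L / 2 by rewrite divr_gt0.
move/cvgrPdist_lt/(_ _ b0): c1 => n1; move/cvgrPdist_lt/(_ _ L2): c2 => n2.
near=> s.
have Js : J s by near: s; exact: nbhs_J.
have s1 : normsq (p s).[z] < L / 2 * eps ^+ q.
  have : `|0 - normsq (p s).[z]| < L / 2 * eps ^+ q by near: s.
  by rewrite sub0r normrN ger0_norm ?normsq_ge0.
have s2 : L / 2 < normsq (p s)`_q.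
  have : `|L - normsq (p s)`_q| < L / 2 by near: s.
  by rewrite ltr_norml => /andP[_]; lra.
have [r [szr _ ps]] := poly_root_list Js.
apply: contrapT => no.
have far w : w \in r -> eps <= normsq (z - w).
  move=> wr; rewrite leNgt; apply/negP => lt; apply: no; exists w; split.
    by rewrite ps rootZ ?root_prod_XsubC // lead_coef_eq0 -size_poly_gt0 size_p.
  by rewrite -opprB /normsq !raddfN /= !sqrrN.
move: s1; rewrite ltNge => /negP; apply.
rewrite ps hornerZ normsqM lead_coefE size_p // horner_prod.
apply: ler_pM; rewrite ?exprn_ge0 ?(ltW eps0) ?(ltW L2) ?(ltW s2) //.
rewrite -szr; elim: (r) far => [|w r' IH] far; first by rewrite big_nil expr0 normsq1.
rewrite big_cons normsqM /= exprS hornerXsubC ler_pM ?exprn_ge0 ?(ltW eps0) //.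
  by apply: far; rewrite mem_head.
by apply: IH => x xr; apply: far; rewrite in_cons xr orbT.
Unshelve. all: by end_near. Qed.

Lemma deriv_neq0 t z : J t -> root (p t) z -> (p t)^`().[z] != 0.
Proof.
move=> Jt pz; have := sep_p Jt; rewrite separable_poly.unlock => cp.
exact: (coprimep_root cp pz).
Qed.

(** The difference quotient of the polynomial with coefficients a, written without division: it is
    continuous across x = y, where it is the derivative. *)
Definition divided_diff (a : nat -> C) (x y : C) : C :=
  \sum_(j < q.+1) a j * \sum_(l < j) x ^+ (j.-1 - l) * y ^+ l.

Lemma divided_diffE a x y : (x - y) * divided_diff a x y =
  \sum_(j < q.+1) a j * x ^+ j - \sum_(j < q.+1) a j * y ^+ j.
Proof.
rewrite /divided_diff mulr_sumr -sumrB; apply: eq_bigr => j _.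
by rewrite mulrCA -mulrBr subrXX.
Qed.

Lemma divided_diff_deriv t z : J t -> divided_diff (fun j => (p t)`_j) z z = (p t)^`().[z].
Proof.
move=> Jt; have pE : p t = \sum_(j < q.+1) (p t)`_j *: 'X^j.
  by rewrite -poly_def -[LHS]coefK size_p.
rewrite [in RHS]pE (raddf_sum (@deriv _)) horner_sum; apply: eq_bigr => j _.
rewrite /= derivZ hornerZ derivXn hornerMn hornerXn.
congr (_ * _); rewrite (eq_bigr (fun=> z ^+ j.-1)); first by rewrite sumr_const card_ord.
move=> l _; by rewrite -exprD subnK //; have := ltn_ord l; lia.
Qed.

(** Implicit differentiation: since w(t+h) is a root of p(t+h) and z a root of p(t), (w(t+h) - z)
    H(t+h) equals minus the increment of p at the fixed point z. Divide by h; H tends to the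
    derivative at z, nonzero by separability. *)
Lemma root_cderive (w : R -> C) t (b : nat -> C) : J t ->
  ccvg (nbhs t) w (w t) -> (\forall s \near t, root (p s) (w s)) ->
  (forall j, cderive (fun s => (p s)`_j) t (b j)) ->
  cderive w t (- (\sum_(j < q.+1) b j * w t ^+ j) * ((p t)^`().[w t])^-1).
Proof.
move=> Jt wc wr bd; have wt : root (p t) (w t) by exact: nbhs_singleton wr.
set z := w t in wt *.
have d0 := deriv_neq0 Jt wt.
pose H s := divided_diff (fun j => (p s)`_j) (w s) z.
have Hc : ccvg 0^' (fun h => H (h + t)) ((p t)^`().[z]).
  apply: ccvg_shift; rewrite -divided_diff_deriv //; apply: ccvg_sum => j.
  apply: ccvgM; first exact: coef_cvg.
  apply: ccvg_sum => l; apply: ccvgM; last exact: ccvg_cst.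
  exact: ccvgX.
have Sc : ccvg 0^' (fun h => \sum_(j < q.+1) slope (fun s => (p s)`_j) t h * z ^+ j)
    (\sum_(j < q.+1) b j * z ^+ j).
  by apply: ccvg_sum => j; apply: ccvgM; [exact: bd | exact: ccvg_cst].
have nearH : \forall h \near 0^', H (h + t) != 0 by exact: ccvg_neq0 d0 Hc.
have shift_near (A : set R) : nbhs t A -> \forall h \near 0^', A (h + t).
  move=> tA; have ct : h + t @[h --> (0 : R)^'] --> t.
    rewrite -[X in _ --> X]add0r; apply: cvgD; last exact: cvg_cst.
    exact: cvg_within.
  exact: ct.
have nearJ := shift_near _ (nbhs_J Jt); have nearR := shift_near _ wr.
rewrite /cderive; apply: ccvg_near_eq; last first.
  by apply: ccvgM; [apply: ccvgN; exact: Sc | apply: ccvgV; [exact: d0 | exact: Hc]].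
near=> h.
have Hh : H (h + t) != 0 by near: h.
have Jh : J (h + t) by near: h.
have Rh : root (p (h + t)) (w (h + t)) by near: h.
apply: (mulIf Hh); rewrite mulfVK // /slope -mulrA divided_diffE -!horner_p //.
rewrite (eqP Rh) sub0r mulrN; congr (- _).
have -> : (p (h + t)).[z] = (p (h + t)).[z] - (p t).[z] by rewrite (eqP wt) subr0.
rewrite !horner_p // -sumrB mulr_sumr; apply: eq_bigr => j _.
by rewrite -mulrBl mulrA.
Unshelve. all: by end_near. Qed.

(** Bootstrapping: the derivative of w is a rational expression in w, the coefficients and their
    derivatives, so it has as many derivatives as w is already known to have. *)
Lemma root_ccn (w : R -> C) t e : near_pt t e `<=` J ->
  (forall m j, ccn m (near_pt t e) (fun s => (p s)`_j)) ->
  (forall s, near_pt t e s -> ccvg (nbhs s) w (w s) /\ root (p s) (w s)) ->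
  forall m, ccn m (near_pt t e) w.
Proof.
move=> eJ ce wP; elim=> [|m IH]; first by split.
have /choice[b bP] : forall j, exists b, (forall s, near_pt t e s ->
    cderive (fun s => (p s)`_j) s (b s)) /\ ccn m (near_pt t e) b.
  by move=> j; apply/ccnS; exact: ce.
apply/ccnS; exists (fun s => - (\sum_(j < q.+1) b j s * w s ^+ j) *
  (divided_diff (fun j => (p s)`_j) (w s) (w s))^-1); split.
  move=> s es; have Js := eJ _ es; have [wc wr] := wP s es.
  rewrite divided_diff_deriv //; apply: (root_cderive (b := fun j => b j s)) => //.
    by apply: filterS (near_pt_nbhs es) => r /wP[].
  by move=> j; exact: (bP j).1.
apply: ccnM.
  apply: ccnN; apply: ccn_sum => j; apply: ccnM; [exact: (bP j).2 | exact: ccnX].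
apply: ccnV.
  move=> s es; have [_ wr] := wP s es.
  by rewrite divided_diff_deriv ?deriv_neq0 //; exact: eJ.
apply: ccn_sum => j; apply: ccnM; first exact: ce.
by apply: ccn_sum => l; apply: ccnM; exact: ccnX.
Qed.

Lemma normsqN (z : C) : normsq (- z) = normsq z.
Proof. by rewrite /normsq !raddfN /= !sqrrN. Qed.

(** For squared moduli the triangle inequality over three steps costs a factor 3, by
    Cauchy-Schwarz. *)
Lemma normsq_triangle (x y z u : C) :
  normsq (x - u) <= 3 * (normsq (x - y) + normsq (y - z) + normsq (z - u)).
Proof.
case: x y z u => [x x'] [y y'] [z z'] [u u']; rewrite /normsq /=.
suff H (a b c : R) : (a + b + c) ^+ 2 <= 3 * (a ^+ 2 + b ^+ 2 + c ^+ 2).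
  have := lerD (H (x - y) (y - z) (z - u)) (H (x' - y') (y' - z') (z' - u')).
  by rewrite !addrA !subrK => /le_trans; apply; lra.
by have := sqr_ge0 (a - b); have := sqr_ge0 (b - c); have := sqr_ge0 (a - c); rewrite !expr2; lra.
Qed.

Lemma positive_lower_bound (I : finType) (F : I -> R) : (forall i, 0 < F i) ->
  exists2 e, 0 < e & forall i, e <= F i.
Proof.
move=> F0; suff [e e0 eF] : exists2 e, 0 < e & forall i, i \in enum I -> e <= F i.
  by exists e => // i; apply: eF; rewrite mem_enum.
elim: (enum I) => [|i s [e e0 eF]]; first by exists 1.
exists (Num.min e (F i)); first by rewrite lt_min e0 F0.
by move=> k; rewrite in_cons ge_min => /predU1P[->|/eF->//]; rewrite lexx orbT.
Qed.

Definition local_root_system (U : set R) (w : 'I_q -> R -> C) :=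
  [/\ U `<=` J, forall m i, ccn m U (w i) &
      forall t, U t -> [/\ injective (w^~ t), forall i, root (p t) (w i t) &
        forall z, root (p t) z -> exists i, z = w i t]].

(** Near each of the q roots of p t0 some root of p t is chosen. Separation keeps the choices
    distinct, so they exhaust the roots, and it also forces each choice to be continuous. *)
Lemma local_roots t0 : J t0 -> exists2 e, 0 < e &
  exists w, local_root_system (near_pt t0 e) w.
Proof.
move=> Jt0; have [s [szs us ps]] := poly_root_list Jt0.
pose z (i : 'I_q) := nth 0 s i.
have lead0 t : J t -> lead_coef (p t) != 0.
  by move=> Jt; rewrite lead_coef_eq0 -size_poly_gt0 size_p.
have zr i : root (p t0) (z i).
  by rewrite ps rootZ ?lead0 // root_prod_XsubC mem_nth // szs.
(* The filler 1 on the diagonal keeps the family positive. *)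
have [d d0 dP] : exists2 d, 0 < d & forall i j, i != j -> d <= normsq (z i - z j).
  have [|d d0 dP] := @positive_lower_bound ('I_q * 'I_q)%type
    (fun ij => if ij.1 == ij.2 then 1 else normsq (z ij.1 - z ij.2)).
    move=> [i j] /=; case: eqP => // /eqP ij; rewrite normsq_gt0 subr_eq0.
    by rewrite nth_uniq ?szs.
  by exists d => // i j /negPf ij; have := dP (i, j); rewrite /= ij.
(* Three steps shorter than eps give a squared distance below 3 * 3 * eps = d. *)
pose eps := d / 9; have eps0 : 0 < eps by rewrite divr_gt0.
have sepz i j x y : normsq (x - z i) < eps -> normsq (x - y) < eps ->
    normsq (y - z j) < eps -> i = j.
  move=> xi xy yj; apply/eqP; apply: contraT => /dP ij.
  have := normsq_triangle (z i) x y (z j).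
  rewrite -[z i - x]opprB normsqN; move: xi xy yj; rewrite /eps; lra.
have /choice[del delP] : forall i, exists e, 0 < e /\ forall t, near_pt t0 e t ->
    exists x, root (p t) x /\ normsq (x - z i) < eps.
  by move=> i; have [e e0 eP] := nbhs_near_pt (near_root Jt0 (zr i) eps0); exists e.
have [e1 e10 [e1J e1c]] := coef_p Jt0.
have [e2 e20 e2P] := positive_lower_bound (fun i => (delP i).1).
pose e := Num.min e1 e2.
have e0 : 0 < e by rewrite lt_min e10.
have ee1 : near_pt t0 e `<=` near_pt t0 e1 by move=> t; rewrite /near_pt /= lt_min => /andP[].
have eJ : near_pt t0 e `<=` J by move=> t /ee1 /e1J.
pose w i t := xget 0 [set x | root (p t) x /\ normsq (x - z i) < eps].
have wP i t : near_pt t0 e t -> root (p t) (w i t) /\ normsq (w i t - z i) < eps.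
  move=> et; have [|x xP] := (delP i).2 t.
    by move: et; rewrite /near_pt /= lt_min => /andP[_ /lt_le_trans]; apply.
  exact: (@xgetPex _ 0 [set x | root (p t) x /\ normsq (x - z i) < eps] (ex_intro _ x xP)).
have w_inj t : near_pt t0 e t -> injective (w^~ t).
  move=> et i j wij; have [_ wi] := wP i t et; have [_ wj] := wP j t et.
  apply: sepz wi _ wj; rewrite wij subrr /normsq /= expr0n addr0 //.
have w_all t x : near_pt t0 e t -> root (p t) x -> exists i, x = w i t.
  move=> et px; have Jt := eJ _ et; have pt0 : p t != 0 by rewrite -size_poly_gt0 size_p.
  apply: contrapT => no.
  (* A further root would make q.+1 distinct roots of a polynomial of degree q. *)
  have := @max_poly_roots _ (p t) (x :: [seq w i t | i : 'I_q]) pt0.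
  rewrite /= size_map size_enum_ord size_p // ltnn => H.
  suff : false by [].
  apply: H; rewrite ?px /=; first by apply/allP => _ /mapP[i _ ->]; have [] := wP i t et.
  rewrite map_inj_uniq ?enum_uniq ?andbT; last exact: w_inj.
  by apply/negP => /mapP[i _ xi]; apply: no; exists i.
exists e => //; exists w; split=> // [m i|t et].
  apply: root_ccn => // [m' j|t et]; first exact: ccn_sub ee1 (e1c m' j).
  have [wr wz] := wP i t et; split=> //; apply: ccvg_normsqP => eps' eps'0.
  have Jt := eJ _ et; have m0 : 0 < Num.min eps eps' by rewrite lt_min eps0.
  have nr := near_root Jt wr m0; have ne := near_pt_nbhs et.
  near=> u; have eu : near_pt t0 e u by near: u.
  (* The root x of p u close to [w i t] is some [w j u]; within eps it can only belong to the index
     i, which proves continuity. *)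
  have [x [xr]] : exists x, root (p u) x /\ normsq (x - w i t) < Num.min eps eps' by near: u.
  rewrite lt_min => /andP[x1 x2]; have [j xj] := w_all u x eu xr.
  have [_ wj] := wP j u eu; rewrite -xj in wj.
  by have ji := sepz _ _ _ _ wj x1 wz; rewrite -{1}ji -xj.
split=> [|i|x]; [exact: w_inj | by have [] := wP i t et | exact: w_all].
Unshelve. all: by end_near. Qed.

End LocalRoots.

(** * Continuation of roots along an interval *)

Section GlobalRoots.
Variable R : realType.
Local Notation C := R[i].
Variables (q : nat) (p : R -> {poly C}) (J : set R).
Hypothesis size_p : forall t, J t -> size (p t) = q.+1.
Hypothesis sep_p : forall t, J t -> separable_poly (p t).
Hypothesis coef_p : forall t, J t -> exists2 e, 0 < e & near_pt t e `<=` J /\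
  forall m j, ccn m (near_pt t e) (fun s => (p s)`_j).
Hypothesis itv_J : is_interval J.

Lemma near_pt_itv (u e v : R) : near_pt u e v <-> u - e < v < u + e.
Proof. by rewrite /near_pt /= ltr_distl. Qed.

(** Near u, g takes values among the branches; jumping to a branch other than the one through g(u)
    would cross the gap d between branches at u. *)
Lemma root_function_local u e (w : 'I_q -> R -> C) g : 0 < e ->
  local_root_system p J (near_pt u e) w ->
  (\forall t \near u, root (p t) (g t)) -> ccvg (nbhs u) g (g u) ->
  exists i, \forall t \near u, g t = w i t.
Proof.
move=> e0 [eJ cw wP] gr gc.
have uu := near_pt_center u e0.
have [w_inj w_root w_all] := wP u uu.
have [i gi] := w_all _ (nbhs_singleton gr); exists i.
have [|d d0 dP] := @positive_lower_bound R 'I_q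
    (fun j => if j == i then 1 else normsq (w i u - w j u)).
  move=> j; case: eqP => // /eqP ji; rewrite normsq_gt0 subr_eq0.
  by apply: contra ji => /eqP/w_inj ->.
have d9 : 0 < d / 9 by rewrite divr_gt0.
have close f : ccvg (nbhs u) f (f u) -> \forall t \near u, normsq (f t - f u) < d / 9.
  move=> fc; have fN : ccvg (nbhs u) (fun t => f t - f u) (f u - f u).
    by apply: ccvgD => //; exact: ccvg_cst.
  have cN : normsq (f t - f u) @[t --> u] --> normsq (f u - f u) by exact: cvg_normsq.
  move/cvgrPdist_lt : cN => /(_ _ d9).
  apply: filterS => t; rewrite subrr /normsq /= expr0n addr0 sub0r normrN.
  by rewrite ger0_norm // normsq_ge0.
have gcl := close g gc.
have wcl : \forall t \near u, forall j, normsq (w j t - w j u) < d / 9.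
  apply: (@filter_forall R 'I_q (fun j t => normsq (w j t - w j u) < d / 9) (nbhs u)) => j.
  apply: close.
  exact: (ccn_ccvg (cw 1%N j) uu).
have une := near_pt_nbhs uu.
near=> t.
have et : near_pt u e t by near: t.
have gt : root (p t) (g t) by near: t.
have [_ _ t_all] := wP t et; have [j gj] := t_all _ gt.
have [<-//|ji] := eqVneq j i.
have lg : normsq (g t - g u) < d / 9 by near: t.
have lw : normsq (w j t - w j u) < d / 9 by move: (j); near: t.
exfalso; have := dP j; rewrite (negPf ji) -gi.
have := normsq_triangle (g u) (g t) (w j t) (w j u).
rewrite -[g u - g t]opprB normsqN gj subrr [X in _ + X + _](_ : _ = 0); last first.
  by rewrite /normsq /= expr0n addr0.
by move: lg lw; rewrite gj; lra.
Unshelve. all: by end_near. Qed.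

Definition root_section (x y : R) (g : R -> C) :=
  forall t, x < t < y -> root (p t) (g t) /\ ccvg (nbhs t) g (g t).

Lemma nbhs_itv (x y t : R) : x < t < y -> \forall s \near t, x < s < y.
Proof.
move=> /andP[xt ty]; have : nbhs t (near_pt t (Num.min (t - x) (y - t))).
  by apply/near_pt_nbhs/near_pt_center; rewrite lt_min !subr_gt0 xt.
by apply: filterS => s; rewrite /near_pt /= lt_min !ltr_norml; lra.
Qed.

(** Near each point both sections are branches of one local system; agreement at a single point
    identifies the indices, so agreement propagates. *)
Lemma root_section_unique x y g1 g2 s : (forall t, x < t < y -> J t) ->
  root_section x y g1 -> root_section x y g2 ->
  x < s < y -> g1 s = g2 s -> forall t, x < t < y -> g1 t = g2 t.
Proof.
move=> xyJ s1 s2 xsy e12 t xty.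
have itv : is_interval [set t : R | x < t < y] by move=> a b /= aI bI c acb; lra.
apply: (interval_propagation (P := fun t => g1 t = g2 t) itv _ xsy xty e12) => u /= xuy.
have Ju := xyJ u xuy.
have [e e0 [w wP]] := local_roots size_p sep_p coef_p Ju.
have nr g : root_section x y g -> \forall t \near u, root (p t) (g t).
  by move=> sg; apply: filterS (nbhs_itv xuy) => r /sg[].
have [i1 n1] := root_function_local e0 wP (nr g1 s1) (s1 u xuy).2.
have [i2 n2] := root_function_local e0 wP (nr g2 s2) (s2 u xuy).2.
have [d d0 dP] := nbhs_near_pt (filterI n1 n2).
exists (Num.min d e); first by rewrite lt_min d0.
move=> v r _ _; rewrite !lt_min => /andP[vd ve] /andP[rd re] gv.
have [v1 v2] := dP v vd; have [r1 r2] := dP r rd.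
have [_ _ /(_ v ve)[w_inj _ _]] := wP.
by rewrite r1 r2; congr (w _ r); apply: w_inj; rewrite -v1 -v2.
Qed.

Variables (t0 : R).
Hypothesis Jt0 : J t0.

Definition section_from (z : C) (v : R) (x y : R) (g : R -> C) :=
  [/\ x < t0 < y, x < v < y, forall t, x < t < y -> J t, root_section x y g & g t0 = z].

(** Reachability of v is propagated along J: a section reaching v1 is prolonged by the local branch
    through its value there. *)
Lemma section_from_ex z v : root (p t0) z -> J v ->
  exists x y g, section_from z v x y g.
Proof.
move=> z0 Jv.
apply: (interval_propagation (P := fun v => exists x y g, section_from z v x y g) itv_J _ Jt0 Jv).
  move=> u Ju; have [e e0 [w wP]] := local_roots size_p sep_p coef_p Ju.
  exists e => // v1 v2 Jv1 Jv2 uv1 uv2 [x [y [g [xt0 xv1 xyJ sg gz]]]].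
  have [eJ cw we] := wP.
  have [_ _ w_all] := we v1 uv1; have [i gi] := w_all _ (sg v1 xv1).1.
  have sw : root_section (u - e) (u + e) (w i).
    move=> t /near_pt_itv et; split; first by have [_ + _] := we t et.
    exact: (ccn_ccvg (cw 1%N i) et).
  have /near_pt_itv iv1 := uv1; have /near_pt_itv iv2 := uv2.
  have agree t : x < t < y -> u - e < t < u + e -> g t = w i t.
    move=> xt ut; apply: (@root_section_unique (Num.max x (u - e)) (Num.min y (u + e)) _ _ v1) => //.
    - by move=> r; rewrite gt_max lt_min => rI; apply: xyJ; lra.
    - by move=> r; rewrite gt_max lt_min => rI; apply: sg; lra.
    - by move=> r; rewrite gt_max lt_min => rI; apply: sw; lra.
    - by rewrite gt_max lt_min; lra.
    - by rewrite gt_max lt_min; lra.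
  (* The two functions agree on the overlap, so near every point the glued function coincides with
     one of them. *)
  exists (Num.min x (u - e)), (Num.max y (u + e)), (fun t => if x < t < y then g t else w i t).
  have cover t : Num.min x (u - e) < t < Num.max y (u + e) ->
      x < t < y \/ u - e < t < u + e.
    rewrite gt_min lt_max => tI; have [lt|ge] := ltP x t.
      have [lt'|ge'] := ltP t y; first by left.
      by right; lra.
    by right; lra.
  split.
  - by rewrite gt_min lt_max; lra.
  - by rewrite gt_min lt_max; lra.
  - by move=> t /cover[/xyJ//|/near_pt_itv/eJ].
  - move=> t /cover[xty|ut].
      have [gr gc] := sg t xty; rewrite xty; split=> //.
      by apply: ccvg_near_eq gc; apply: filterS (nbhs_itv xty) => r ->.
    have [wr wc] := sw t ut; have -> : (if x < t < y then g t else w i t) = w i t.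
      by case: ifP => // xty; exact: agree.
    split=> //; apply: ccvg_near_eq wc; apply: filterS (nbhs_itv ut) => r ur.
    by case: ifP => // xry; rewrite agree.
  - by rewrite xt0.
have [e e0 [w wP]] := local_roots size_p sep_p coef_p Jt0; have [eJ cw we] := wP.
have tt0 := near_pt_center t0 e0.
have [_ _ w_all] := we t0 tt0; have [i zi] := w_all _ z0.
have /near_pt_itv it0 := tt0.
exists (t0 - e), (t0 + e), (w i); split=> //; first by move=> t /near_pt_itv/eJ.
move=> t /near_pt_itv et; split; first by have [_ + _] := we t et.
exact: (ccn_ccvg (cw 1%N i) et).
Qed.

Lemma section_from_agree z z' v v' x y g x' y' g' :
  section_from z v x y g -> section_from z' v' x' y' g' ->
  forall s t, x < s < y -> x' < s < y' -> x < t < y -> x' < t < y' ->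
  g s = g' s -> g t = g' t.
Proof.
move=> [_ _ xyJ sg _] [_ _ _ sg' _] s t s1 s2 t1 t2 e.
apply: (@root_section_unique (Num.max x x') (Num.min y y') g g' s) => //.
- by move=> r; rewrite gt_max lt_min => rI; apply: xyJ; lra.
- by move=> r; rewrite gt_max lt_min => rI; apply: sg; lra.
- by move=> r; rewrite gt_max lt_min => rI; apply: sg'; lra.
- by rewrite gt_max lt_min; lra.
- by rewrite gt_max lt_min; lra.
Qed.

(** The value is independent of the section chosen, because all sections start from z at t0; the
    default 0 only serves points that cannot be reached. *)
Definition continuation z v : C :=
  xget 0 [set c | exists x y g, section_from z v x y g /\ c = g v].

Lemma continuationE z v x y g t : section_from z v x y g -> x < t < y ->
  continuation z t = g t.
Proof.
move=> sf xty; have [xt0 xv xyJ sg gz] := sf.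
have sft : section_from z t x y g by [].
have : exists c, [set c | exists x y g, section_from z t x y g /\ c = g t] c.
  by exists (g t), x, y, g.
case=> c cP; rewrite /continuation; have [x' [y' [g' [sf' ->]]]] := @xgetPex _ 0 _ (ex_intro _ c cP).
have [xt0' xt' _ _ gz'] := sf'.
by apply: (section_from_agree sf' sft xt0'); rewrite ?gz.
Qed.

(** Continuations of distinct roots stay distinct, since agreement at t would propagate back to t0.
    Being q distinct roots in degree q, they give the factorization. *)
Lemma global_roots : exists w : 'I_q -> R -> C, forall t, J t ->
  p t = lead_coef (p t) *: \prod_i ('X - (w i t)%:P) /\
  forall i, exists2 e, 0 < e & forall m, ccn m (near_pt t e) (w i).
Proof.
have [s [szs us ps]] := poly_root_list size_p sep_p Jt0.
have s_root i : (i < q)%N -> root (p t0) s`_i.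
  move=> iq; have l0 : lead_coef (p t0) != 0 by rewrite lead_coef_eq0 -size_poly_gt0 size_p.
  by rewrite ps rootZ // root_prod_XsubC mem_nth // szs.
exists (fun i => continuation s`_i) => t Jt.
have secs (i : 'I_q) := section_from_ex (s_root i (ltn_ord i)) Jt.
split.
  have pt0 : p t != 0 by rewrite -size_poly_gt0 size_p.
  have -> : \prod_(i < q) ('X - (continuation s`_i t)%:P) =
      \prod_(z <- [seq continuation s`_i t | i : 'I_q]) ('X - z%:P).
    by rewrite big_map big_enum.
  apply: all_roots_prod_XsubC; first by rewrite size_map size_enum_ord size_p.
    apply/allP => _ /mapP[i _ ->]; have [x [y [g sf]]] := secs i.
    have [_ xty _ sg _] := sf; rewrite (continuationE sf xty).
    exact: (sg t xty).1.
  rewrite uniq_rootsE map_inj_uniq ?enum_uniq // => i j.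
  have [x [y [g sf]]] := secs i; have [x' [y' [g' sf']]] := secs j.
  have [xt0 xty _ _ gz] := sf; have [xt0' xty' _ _ gz'] := sf'.
  rewrite (continuationE sf xty) (continuationE sf' xty') => gg.
  have := section_from_agree sf sf' xty xty' xt0 xt0' gg.
  rewrite gz gz' => /eqP; rewrite nth_uniq ?szs // => /eqP e; exact: val_inj.
move=> i; have [x [y [g sf]]] := secs i; have [_ xty xyJ sg _] := sf.
have [e e0 [w wP]] := local_roots size_p sep_p coef_p Jt.
have nr : \forall r \near t, root (p r) (g r) by apply: filterS (nbhs_itv xty) => r /sg[].
have [j nj] := root_function_local e0 wP nr (sg t xty).2.
have [d d0 dP] := nbhs_near_pt (filterI nj (filterI (nbhs_itv xty) (near_pt_nbhs (near_pt_center t e0)))).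
exists d => // m; apply: (@ccn_eq _ _ _ (w j)); first exact: open_near_pt.
  by move=> r /dP[gw [xry _]]; rewrite (continuationE sf xry).
have [_ cw _] := wP; apply: ccn_sub (cw m j) => r /dP[_ [_ +]]; exact.
Qed.

End GlobalRoots.

(** * Finitely many exceptional parameters *)

Section PiecewiseRoots.
Variable R : realType.
Local Notation C := R[i].

Definition csmooth (f : R -> C) t := exists2 e, 0 < e & forall m, ccn m (near_pt t e) f.

Lemma csmooth_near_eq f g t : (\forall s \near t, f s = g s) -> csmooth f t -> csmooth g t.
Proof.
move=> /nbhs_near_pt[d d0 fg] [e e0 cf]; exists (Num.min d e); first by rewrite lt_min d0.
move=> m; apply: (@ccn_eq _ _ _ f); first exact: open_near_pt.
  by move=> s; rewrite /near_pt /= lt_min => /andP[sd _]; exact: fg.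
by apply: ccn_sub (cf m) => s; rewrite /near_pt /= lt_min => /andP[].
Qed.

Section FiniteExceptions.
Variables (q : nat) (p : R -> {poly C}) (good : R -> Prop).
Hypothesis size_p : forall t, good t -> size (p t) = q.+1.
Hypothesis sep_p : forall t, good t -> separable_poly (p t).
Hypothesis coef_p : forall t, good t -> exists2 e, 0 < e &
  forall m j, ccn m (near_pt t e) (fun s => (p s)`_j).

(** Induction on the bad points: the interval is cut at x, which becomes exceptional, and the labels
    on the two sides are joined arbitrarily. *)
Lemma finite_exceptions_roots (l : seq R) a b :
  (forall t, a < t < b -> t \notin l -> good t) ->
  exists E : set R, finite_set E /\ exists w : 'I_q -> R -> C, forall t, a < t < b -> ~ E t ->
    p t = lead_coef (p t) *: \prod_i ('X - (w i t)%:P) /\ forall i, csmooth (w i) t.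
Proof.
elim: l a b => [|x l IH] a b gd.
  have [ab|ba] := ltP a b; last first.
    exists set0; split; first exact: finite_set0.
    by exists (fun _ _ => 0) => t tab; exfalso; lra.
  exists set0; split; first exact: finite_set0.
  pose J : set R := [set t | a < t < b].
  have JP t : J t -> good t by move=> Jt; apply: gd.
  have [|||||w wP] := @global_roots R q p J _ _ _ _ ((a + b) / 2).
  - by move=> t /JP; exact: size_p.
  - by move=> t /JP; exact: sep_p.
  - move=> t Jt; have [e e0 ce] := coef_p (JP t Jt).
    have [d d0 dJ] := nbhs_near_pt (nbhs_itv Jt).
    exists (Num.min d e); first by rewrite lt_min d0.
    split=> [s|m j]; first by rewrite /near_pt /= lt_min => /andP[sd _]; exact: dJ.
    by apply: ccn_sub (ce m j) => s; rewrite /near_pt /= lt_min => /andP[].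
  - by move=> s t; rewrite /J /= => sI tI r srt; lra.
  - by rewrite /J /= !(midf_lt ab).
  by exists w => t tab _; have [pt wt] := wP t tab; split.
have [axb|naxb] := boolP (a < x < b); last first.
  apply: IH => t tab tl; apply: gd => //; rewrite in_cons negb_or tl andbT.
  by apply: contraNneq naxb => <-.
have [|E1 [E1f [w1 w1P]]] := IH a x.
  move=> t tax tl; apply: gd; first by lra.
  by rewrite in_cons negb_or tl andbT lt_eqF //; move/andP: tax => [].
have [|E2 [E2f [w2 w2P]]] := IH x b.
  move=> t txb tl; apply: gd; first by lra.
  by rewrite in_cons negb_or tl andbT gt_eqF //; move/andP: txb => [].
exists (E1 `|` E2 `|` [set x]); split.
  by rewrite !finite_setU; split; [split | exact: finite_set1].
exists (fun i t => if t < x then w1 i t else w2 i t) => t tab /not_orP[/not_orP[nE1 nE2] /eqP tx].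
have [ltx|] := ltP t x.
  have [|pt wt] := w1P t _ nE1; first by lra.
  split=> // i; apply: csmooth_near_eq (wt i).
  have ta : a < t < x by lra.
  by apply: filterS (nbhs_itv ta) => s /andP[_ ->].
rewrite le_eqVlt eq_sym (negPf tx) /= => gtx.
have [|pt wt] := w2P t _ nE2; first by lra.
split=> // i; apply: csmooth_near_eq (wt i).
have ta : x < t < b by lra.
by apply: filterS (nbhs_itv ta) => s /andP[xs _]; rewrite ltNge (ltW xs).
Qed.

End FiniteExceptions.

Definition evalC (t : R) : {poly anafun R} -> {poly C} :=
  map_poly (real_complex R) \o map_poly (anafun_eval t).

HB.instance Definition _ t := GRing.RMorphism.on (evalC t).

Lemma coef_evalC (t : R) (P : {poly anafun R}) i : (evalC t P)`_i = (P`_i t)%:C%C.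
Proof. by rewrite /evalC /= !coef_map. Qed.

Lemma evalC_C (t : R) (c : anafun R) : evalC t c%:P = (c t)%:C%C%:P.
Proof. by rewrite /evalC /= !map_polyC. Qed.

Lemma evalC_deriv (t : R) (P : {poly anafun R}) : evalC t (deriv P) = deriv (evalC t P).
Proof. by rewrite /evalC /= !deriv_map. Qed.

Lemma size_evalC (t : R) (P : {poly anafun R}) : lead_coef P t != 0 ->
  size (evalC t P) = size P /\ lead_coef (evalC t P) = (lead_coef P t)%:C%C.
Proof.
move=> l0; have sz : size (evalC t P) = size P.
  apply/eqP; rewrite eqn_leq; apply/andP; split.
    by apply/leq_sizeP => j jP; rewrite coef_evalC nth_default.
  have P0 : (0 < size P)%N.
    by rewrite lt0n size_poly_eq0; apply: contraNneq l0 => ->; rewrite lead_coef0.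
  rewrite -(prednK P0) ltnNge; apply/negP => /leq_sizeP/(_ _ (leqnn _)).
  rewrite coef_evalC -lead_coefE => /(congr1 (@complex.Re R)) /= e.
  by rewrite e eqxx in l0.
by split=> //; rewrite lead_coefE sz coef_evalC.
Qed.

Lemma anafun_torsion_free (f : anafun R) m : f *+ m.+1 = 0 -> f = 0.
Proof.
move=> fm; apply: anafun_eq => t _; have := congr1 (anafun_eval t) fm.
by rewrite raddfMn raddf0 /= => /eqP; rewrite mulrn_eq0 /= => /eqP.
Qed.

Lemma anafun_deriv_neq0 (P : {poly anafun R}) : (1 < size P)%N -> deriv P != 0.
Proof.
move=> P1; apply: contraTneq P1 => P'0; rewrite -leqNgt; apply/leq_sizeP => -[//|j] _.
by have := coef_deriv P j; rewrite P'0 coef0 => /esym/anafun_torsion_free.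
Qed.

(** The Bezout relation has a nonzero constant e of the domain on its right side; evaluated at t
    with e(t) nonzero, it makes the complex polynomial coprime to its derivative. A nonzero leading
    coefficient keeps the degree. *)
Lemma coprime_deriv_roots (P : {poly anafun R}) q : size P = q.+1 ->
  Pdiv.Idomain.coprimep P (deriv P) ->
  exists E : set R, finite_set E /\ exists w : 'I_q -> R -> C, forall t, 0 <= t <= 1 -> ~ E t ->
    evalC t P = (lead_coef P t)%:C%C *: \prod_i ('X - (w i t)%:P) /\ forall i, csmooth (w i) t.
Proof.
move=> szP cp; have [[u v] /= uv] := Pdiv.Idomain.Bezout_coprimepP _ _ cp.
have /size_poly1P[e e0 uvE] : size (u * P + v * deriv P) == 1 by rewrite (Pdiv.Idomain.eqp_size uv) size_poly1.
have l0 : lead_coef P != 0 by rewrite lead_coef_eq0 -size_poly_gt0 szP.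
have /anafun_zeros/finite_seqP[l lE] : e * lead_coef P != 0 by rewrite mulf_neq0.
pose good t := 0 < t < 1 /\ (e * lead_coef P) t != 0.
have goodM t : good t -> e t != 0 /\ lead_coef P t != 0.
  by move=> [_]; rewrite [X in X != 0]/(e t * lead_coef P t) mulf_eq0 negb_or => /andP[].
have [||||E [Ef [w wP]]] := @finite_exceptions_roots q (evalC^~ P) good _ _ _ l 0 1.
- by move=> t /goodM[_ lt]; have [-> _] := size_evalC lt.
- move=> t /goodM[et lt]; rewrite separable_poly.unlock -evalC_deriv.
  apply/Pdiv.Idomain.Bezout_coprimepP; exists (evalC t u, evalC t v) => /=.
  have := congr1 (evalC t) uvE; rewrite (rmorphD (evalC t)) !(rmorphM (evalC t)) /= evalC_C => ->.
  rewrite -size_poly_eq1 size_polyC.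
  by rewrite (inj_eq (@complexI R)) et.
- move=> t [t01 _].
  have /choice[ee eeP] : forall j : 'I_q.+1, exists d, 0 < d /\ forall m, cn m (near_pt t d) (P`_j).
    move=> j; have [d d0 dP] := analytic_cn (anafunP (P`_j)).1 t01.
    by exists d.
  have [d d0 dP] := positive_lower_bound (fun j => (eeP j).1).
  exists d => // m j; have [jq|qj] := ltnP j q.+1.
    split; last by under [X in cn _ _ X]funext do rewrite coef_evalC /=; exact: cn_cst.
    under [X in cn _ _ X]funext do rewrite coef_evalC /=.
    apply: cn_sub ((eeP (Ordinal jq)).2 m) => s; rewrite /near_pt /= => /lt_le_trans; apply.
    exact: dP.
  apply: (@ccn_eq _ _ _ (fun=> 0)); [exact: open_near_pt | | exact: ccn_cst].
  by move=> s _; rewrite coef_evalC nth_default ?szP.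
- move=> t t01 tl; split=> //; apply: contra tl => /eqP et.
  have : [set` l] t by rewrite -lE; split=> //; rewrite !ltW; move/andP: t01 => [].
  by [].
(* The endpoints are added because separability and smooth coefficients were arranged on open
   neighbourhoods inside (0, 1). *)
exists (E `|` [set` l] `|` [set 0] `|` [set 1]); split.
  rewrite !finite_setU; repeat split=> //; exact: finite_seq.
exists w => t t01 /not_orP[/not_orP[/not_orP[nE nl] /eqP t0] /eqP t1].
have tI : 0 < t < 1 by move: t01; rewrite !le_eqVlt eq_sym (negPf t0) (negPf t1).
have el : (e * lead_coef P) t != 0.
  by apply/eqP => elt; apply: nl; rewrite -lE.
have [_ lt] := goodM t (conj tI el).
have [pt wt] := wP t tI nE; split=> //.
by rewrite pt (size_evalC lt).2.
Qed.

(** Recursion on c P = H G with G the gcd of P and its derivative. G is smaller because it divides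
    the derivative, H because G is nonconstant; either may still have repeated roots, so both are
    treated by induction. *)
Lemma analytic_poly_roots (P : {poly anafun R}) : P != 0 ->
  exists E : set R, finite_set E /\ exists ws : seq (R -> C), size ws = (size P).-1 /\
    forall t, 0 <= t <= 1 -> ~ E t ->
    evalC t P = (lead_coef P t)%:C%C *: \prod_(w <- ws) ('X - (w t)%:P) /\
    forall i, csmooth (nth (fun=> 0) ws i) t.
Proof.
have [n le_Pn] := ubnP (size P); elim: n => // n IH in P le_Pn * => P0.
have cst_smooth t : csmooth (fun=> 0) t by exists 1 => // m; exact: ccn_cst.
have [P1|P1] := leqP (size P) 1.
  exists set0; split; first exact: finite_set0.
  exists [::]; split; first by case: (size P) P1 => [|[]].
  move=> t _ _; split; last by move=> i; rewrite nth_nil.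
  by rewrite big_nil alg_polyC {1}(size1_polyC P1) evalC_C lead_coefE; case: (size P) P1 => [|[]].
have [cp|ncp] := boolP (Pdiv.Idomain.coprimep P (deriv P)).
  have [q szP] : exists q, size P = q.+1 by exists (size P).-1; rewrite prednK // ltnW.
  have [E [Ef [w wP]]] := coprime_deriv_roots szP cp.
  exists E; split=> //; exists [seq w i | i <- enum 'I_q]; split.
    by rewrite size_map size_enum_ord szP.
  move=> t t01 nE; have [-> wt] := wP t t01 nE; split.
    by rewrite big_map big_enum.
  move=> i; have [iq|qi] := ltnP i q.
    by rewrite (nth_map (Ordinal iq)) ?size_enum_ord.
  by rewrite nth_default // size_map size_enum_ord.
set G := gcdp P (deriv P).
have P'0 := anafun_deriv_neq0 P1.
have G0 : G != 0 by rewrite Pdiv.Idomain.gcdp_eq0 negb_and P0.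
have G1 : (1 < size G)%N.
  by rewrite ltn_neqAle eq_sym -Pdiv.Idomain.coprimep_def ncp size_poly_gt0.
have GP : (size G < size P)%N.
  apply: leq_ltn_trans (lt_size_deriv P0).
  by apply: Pdiv.Idomain.dvdp_leq => //; exact: Pdiv.Idomain.dvdp_gcdr.
have [[c H] /= c0 cP] := Pdiv.Idomain.dvdpP _ _ (Pdiv.Idomain.dvdp_gcdl P (deriv P)).
rewrite -/G in cP.
have H0 : H != 0.
  have : c *: P != 0 by rewrite -mul_polyC mulf_neq0 ?polyC_eq0.
  by rewrite cP mulf_eq0 negb_or => /andP[].
have szHG : size P = (size H + size G).-1 by rewrite -(size_scale P c0) cP size_mul.
have HP : (size H < size P)%N by move: szHG G1; move: (size H) (size G); clear; lia.
have [E1 [E1f [w1 [sz1 w1P]]]] := IH G (leq_trans GP le_Pn) G0.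
have [E2 [E2f [w2 [sz2 w2P]]]] := IH H (leq_trans HP le_Pn) H0.
have zc := anafun_zeros c0.
exists (E1 `|` E2 `|` [set t | 0 <= t <= 1 /\ c t = 0]); split.
  by rewrite !finite_setU.
exists (w1 ++ w2); split.
  rewrite size_cat sz1 sz2 szHG; move: G1; rewrite -size_poly_gt0 in H0; move: H0.
  by move: (size H) (size G); clear; lia.
move=> t t01 /not_orP[/not_orP[nE1 nE2] nc].
have [e1 s1] := w1P t t01 nE1; have [e2 s2] := w2P t t01 nE2.
split; last by move=> i; rewrite nth_cat; case: ifP.
have ct : (c t)%:C%C != 0 :> C.
  by apply/eqP => /(congr1 (@complex.Re R)) /= ct0; apply: nc.
apply: (scalerI ct).
have := congr1 (evalC t) cP; rewrite -mul_polyC !(rmorphM (evalC t)) /= evalC_C mul_polyC => ->.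
have /(congr1 (real_complex R)) lE : c t * lead_coef P t = lead_coef H t * lead_coef G t.
  have := congr1 (fun Q : {poly anafun R} => lead_coef Q t) cP.
  by rewrite /= lead_coefZ lead_coefM => e; exact: e.
rewrite !(rmorphM (real_complex R)) in lE.
rewrite e1 e2 big_cat /= -scalerAl -scalerAr !scalerA lE; congr (_ *: _).
exact: mulrC.
Qed.

End PiecewiseRoots.

(** * Application to eigenvalues *)

Lemma csmooth_complex_smooth_at (R : realType) (D : set R) (f : R -> R[i]) t :
  csmooth f t -> complex_smooth_at D f t.
Proof. by move=> [e e0 fe]; split; apply: (@cn_smooth_at _ _ _ _ e) => // m; case: (fe m). Qed.

(** [Res] has integer coefficients, so the characteristic polynomial can be formed over the analytic
    functions and commutes with evaluation at t. Degree and leading coefficient are then read off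
    pointwise from the complex case. *)
Lemma char_poly_family (R : realType) (n d : nat)
    (Res : mpoly.mpoly (num_coefs n.+1 d.+1) int) (hRes : is_resultant R[i] Res)
    (A : R -> hypermatrix R d.+2 n.+1) :
  (forall I : d.+2.-tuple 'I_n.+1, real_analytic_on `[0, 1]%classic (fun t => A t I)) ->
  exists P : {poly anafun R}, [/\ size P = (n.+1 * d.+1 ^ n).+1, lead_coef P = 1 &
    forall t, 0 <= t <= 1 ->
      evalC t P = hm_char_poly (k := d.+2) Res (fun I => (A t I)%:C%C)].
Proof.
move=> A_analytic.
have /choice[A' A'E] : forall I, exists f : anafun R, forall t, 0 <= t <= 1 -> f t = A t I.
  by move=> I; apply: anafun_of.
pose P := hm_char_poly (k := d.+2) Res A'; exists P.
have PE t : 0 <= t <= 1 -> evalC t P = hm_char_poly (k := d.+2) Res (fun I => (A t I)%:C%C).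
  move=> t01; rewrite /evalC /= !rmorph_hm_char_poly; congr (hm_char_poly _ _).
  by apply/funext => I; rewrite /= /anafun_eval A'E.
have mon t : 0 <= t <= 1 -> evalC t P \is monic /\ size (evalC t P) = (n.+1 * d.+1 ^ n).+1.
  by move=> t01; rewrite PE //; exact: hm_char_poly_monic.
have szP : (size P <= (n.+1 * d.+1 ^ n).+1)%N.
  apply/leq_sizeP => j jN; apply: anafun_eq => t /mon[_ sz].
  have := nth_default 0 (s := evalC t P) (n := j).
  by rewrite sz coef_evalC => /(_ jN) /(congr1 (@complex.Re R)).
have lP : P`_(n.+1 * d.+1 ^ n) = 1.
  apply: anafun_eq => t /mon[/monicP]; rewrite lead_coefE => + sz; rewrite sz coef_evalC.
  by move=> /(congr1 (@complex.Re R)).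
have szE : size P = (n.+1 * d.+1 ^ n).+1.
  apply/eqP; rewrite eqn_leq szP ltnNge; apply/negP => le.
  by have := oner_neq0 (anafun R); rewrite -lP nth_default ?eqxx.
by split=> //; rewrite lead_coefE szE.
Qed.

Lemma smooth_eigenvalues (R : realType) (n d : nat)
    (Res : mpoly.mpoly (num_coefs n.+1 d.+1) int) (hRes : is_resultant R[i] Res)
    (A : R -> hypermatrix R d.+2 n.+1) (N := (n.+1 * d.+1 ^ n)%N) :
  (forall I : d.+2.-tuple 'I_n.+1, real_analytic_on `[0, 1]%classic (fun t => A t I)) ->
  exists lambda : 'I_N -> R -> R[i],
    (forall t, `[0, 1]%classic t ->
       hm_char_poly (k := d.+2) Res (fun I => (A t I)%:C%C) =
       \prod_(i < N) ('X - (lambda i t)%:P)) /\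
    (forall i, exists E : set R, finite_set E /\
       forall t, `[0, 1]%classic t -> ~ E t ->
         complex_smooth_at `[0, 1]%classic (lambda i) t).
Proof.
move=> A_analytic.
have [P [szP lP PE]] := char_poly_family hRes A_analytic.
have P0 : P != 0 by rewrite -size_poly_gt0 szP.
have [E [Ef [ws [szw wP]]]] := analytic_poly_roots P0.
rewrite -/N in szP; rewrite szP /= in szw.
have /choice[rs rsP] t : exists s : seq R[i], 0 <= t <= 1 ->
    size s = N /\ evalC t P = \prod_(z <- s) ('X - z%:P).
  have [s sP] := closed_field_poly_normal (evalC t P); exists s => t01.
  have lt : lead_coef P t = 1 by rewrite lP.
  have [sz lE] : size (evalC t P) = size P /\ lead_coef (evalC t P) = (lead_coef P t)%:C%C.
    by apply: size_evalC; rewrite lt oner_neq0.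
  move: sP; rewrite lE lt scale1r => sP; split=> //.
  by move: sz; rewrite sP szP size_prod_XsubC => -[].
(* On E the smooth branches need not list the roots, so an arbitrary factorization at t supplies the
   values there. *)
exists (fun i t => if `[< E t >] then (rs t)`_i else nth (fun=> 0) ws i t); split.
  move=> t; rewrite /= in_itv /= => t01; rewrite -PE //.
  have [Et|nE] := asboolP (E t).
    have [sz ->] := rsP t t01.
    by rewrite (big_nth 0) sz big_mkord.
  have [-> _] := wP t t01 nE; rewrite lP (_ : (1 : anafun R) t = 1) // scale1r.
  by rewrite (big_nth (fun=> 0)) szw big_mkord.
move=> i; exists E; split=> // t; rewrite /= in_itv /= => t01 nE.
apply: csmooth_complex_smooth_at.
have [_ /(_ i)] := wP t t01 nE; apply: csmooth_near_eq.
(* E is finite, hence closed, so the values substituted on E do not affect the functions near a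
   point outside E. *)
have oE : open (~` E).
  apply: closed_openC.
  have /accessible_finite_set_closed cl : accessible_space R.
    by apply: hausdorff_accessible; exact: norm_hausdorff.
  exact: cl.
by apply: filterS (open_nbhs_nbhs (conj oE nE)) => s nEs; case: asboolP.
Qed.

End AnalyticRoots.

Import AnalyticRoots.
From mathcomp Require Import classical_sets cardinality set_interval reals.
Local Open Scope classical_set_scope.

Theorem theorem10 (R : realType) (k n : nat) (hk : (2 <= k)%N) (hn : (1 <= n)%N)
    (Res : mpoly.mpoly (num_coefs n k.-1) int)
    (hRes : is_resultant R[i] Res)
    (A : R -> hypermatrix R k n)
    (A_sym : forall t, `[0, 1]%classic t -> symmetric_hm (A t))
    (A_analytic : forall I : k.-tuple 'I_n,
       real_analytic_on `[0, 1]%classic (fun t => A t I)) :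
  exists lambda : 'I_(n * k.-1 ^ n.-1) -> R -> R[i],
    (forall t, `[0, 1]%classic t ->
       hm_char_poly Res (fun I => (A t I)%:C%C) =
       \prod_(i < n * k.-1 ^ n.-1) ('X - (lambda i t)%:P)) /\
    (forall i, exists E : set R, finite_set E /\
       forall t, `[0, 1]%classic t -> ~ E t ->
         complex_smooth_at `[0, 1]%classic (lambda i) t).
Proof.
case: n hn => [//|n] _ in Res hRes A A_sym A_analytic *.
case: k hk => [|[//|d]] // _ in Res hRes A A_sym A_analytic *.
exact: smooth_eigenvalues.
Qed.
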